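(* Let $T^\dagger$ be the $\mathcal{L}_{\mathrm{rings}}$-theory of pseudo-finite fields and $T^+=T^+(T^\dagger)$. For each prime $p$ let $M_p$ be the $\mathcal{L}_{K,V,c}$-structure whose field sort is $\mathbb{F}_p$ and whose vector sort is $\mathbf{L}_{c,p}$, with $P_1,\dots,P_{c+1}$ interpreted as the distinguished Lazard series and $\theta_n,\pi_{n,i}$ as prescribed by $T_0$. If $\mathcal{D}$ is a non-principal ultrafilter on the set of primes, then $\prod_p M_p/\mathcal{D}\models T^+$.
   Context: Fix an integer $c\ge 1$. For a Lie algebra $L$ over a field, a Lazard series (of length $c+1$) is a chain of subalgebras $L=L_1\supseteq\dots\supseteq L_{c+1}=0$ with $[L_i,L_j]\subseteq L_{i+j}$ for all $i,j$ ($L_k=0$ for $k>c$); a Lazard Lie algebra (LLA) of class at most $c$ is a Lie algebra with a distinguished Lazard series of this length. $\mathbf{L}_{c,p}$ denotes the Fraïssé limit of the class of finite LLAs of class at most $c$ over $\mathbb{F}_p$ (viewed as structures in the language of Lie algebras over $\mathbb{F}_p$ with unary predicates for the terms of the distinguished series); this Fraïssé limit exists. The two-sorted language $\mathcal{L}_{K,V,c}$ has a field sort $K$ with the ring language; a vector sort $V$ with $0_V$, binary functions $+,-,[\cdot,\cdot]:V^2\to V$, unary predicates $P_1,\dots,P_{c+1}$, and $n$-ary relations $\theta_n$ ($n\ge1$); a function $\cdot:K\times V\to V$; and functions $\pi_{n,i}:V^{n+1}\to K$ ($1\le i\le n$). $T_0$ states: $K$ is a field; $V$ is a $K$-vector space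 under $\cdot$; $[\cdot,\cdot]$ is alternating, $K$-bilinear and satisfies Jacobi; $(P_i(V))_{1\le i\le c+1}$ is a Lazard series of $K$-subspaces; $\theta_n(v_1,\dots,v_n)$ iff $v_1,\dots,v_n$ are linearly independent; $\pi_{n,i}(v_1,\dots,v_n,w)=\alpha_i$ if the $v_j$ are linearly independent and $w=\sum_j\alpha_jv_j$, and $0$ otherwise. A tuple $\bar\alpha=(\alpha_{i,j,k})_{i,j,k\in[n]}\in K^{n^3}$ is a tuple of structure constants if on $K^n$ with basis $e_1,\dots,e_n$ the bilinear map $[e_i,e_j]=\sum_k\alpha_{i,j,k}e_k$ is alternating and satisfies Jacobi, and for some permutation $\sigma$ of $[n]$ and $n=k_1\ge\dots\ge k_{c+1}=0$ the subspaces $\mathrm{span}\{e_{\sigma(l)}:l\le k_i\}$ form a Lazard series. For a basis $\bar v$ of a Lie subalgebra of $V$, $\mathrm{Str}_n(\bar v)=(\pi_{n,k}(v_1,\dots,v_n,[v_i,v_j]))_{i,j,k\in[n]}$. For an $\mathcal{L}_{\mathrm{rings}}$-theory $T^\dagger$ of fields, $T^+(T^\dagger)$ is $T_0$ together with: $K\models T^\dagger$ and $V$ is infinite-dimensional; for every $n$ every tuple of structure constants in $K^{n^3}$ is $\mathrm{Str}_n(\bar v)$ for some basis $\bar v\in V^n$ of a Lie subalgebra; and for all $n<m$, if $\bar v\in V^n$ is a basis of a Lie subalgebra and $\bar\alpha\in K^{(n+m)^3}$ is a tuple of structure constants with $\alpha_{i,j,k}=\mathrm{Str}_n(\bar v)_{i,j,k}$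 for $i,j,k\le n$ and $\alpha_{i,j,k}=0$ for $i,j\le n<k$, then some $\bar w\in V^m$ makes $(\bar v,\bar w)$ a basis of a Lie subalgebra with $\mathrm{Str}_{n+m}(\bar v,\bar w)=\bar\alpha$.
   Formalization: In T⁺'s extension axiom, it is also required that K^{n+m} with the bracket given by ᾱ admit a Lazard series inducing on span(v̄) the series given by P_1,…,P_{c+1}; without this the axiom fails for c≥2 (nonzero v in P_c, Heisenberg algebra). *)

(* Defs.v *)
From HB Require Import structures.
From mathcomp Require Import all_boot all_order all_algebra all_fingroup.
From mathcomp Require Import all_classical.

Set Implicit Arguments.
Unset Strict Implicit.
Unset Printing Implicit Defensive.
Local Open Scope classical_set_scope.

(** * Structures and sentences in the language of rings *)

Record ring_struct := RingStruct {
  rcar :> Type;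
  rzero : rcar;
  rone : rcar;
  radd : rcar -> rcar -> rcar;
  rsub : rcar -> rcar -> rcar;
  rmul : rcar -> rcar -> rcar
}.
Arguments rzero {r}.
Arguments rone {r}.

Record is_field (R : ring_struct) : Prop := IsField {
  fld_addA : forall x y z : R, radd x (radd y z) = radd (radd x y) z;
  fld_addC : forall x y : R, radd x y = radd y x;
  fld_add0 : forall x : R, radd rzero x = x;
  fld_sub : forall x y : R, radd (rsub x y) y = x;
  fld_mulA : forall x y z : R, rmul x (rmul y z) = rmul (rmul x y) z;
  fld_mulC : forall x y : R, rmul x y = rmul y x;
  fld_mul1 : forall x : R, rmul rone x = x;
  fld_mulD : forall x y z : R, rmul x (radd y z) = radd (rmul x y) (rmul x z);
  fld_one_neq0 : rone <> rzero :> R;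
  fld_inv : forall x : R, x <> rzero -> exists y, rmul y x = rone
}.

Definition ring_struct_of (F : fieldType) : ring_struct :=
  @RingStruct F 0%R 1%R (fun x y => x + y)%R (fun x y => x - y)%R
    (fun x y => x * y)%R.

(* [rformula n]: formulas whose free variables are among [n] variables. *)
Inductive rterm (n : nat) : Type :=
| RVar of 'I_n
| RZero
| ROne
| RAdd of rterm n & rterm n
| RSub of rterm n & rterm n
| RMul of rterm n & rterm n.

Inductive rformula : nat -> Type :=
| REq n of rterm n & rterm n : rformula n
| RFalse n : rformula n
| RImp n of rformula n & rformula n : rformula n
| RForall n of rformula n.+1 : rformula n.

Notation rsentence := (rformula 0).

Definition env_cons (T : Type) n (x : T) (e : 'I_n -> T) : 'I_n.+1 -> T :=
  fun i => if unlift ord0 i is Some j then e j else x.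

Fixpoint reval (R : ring_struct) n (e : 'I_n -> R) (t : rterm n) : R :=
  match t with
  | RVar i => e i
  | RZero => rzero
  | ROne => rone
  | RAdd t1 t2 => radd (reval e t1) (reval e t2)
  | RSub t1 t2 => rsub (reval e t1) (reval e t2)
  | RMul t1 t2 => rmul (reval e t1) (reval e t2)
  end.

Fixpoint rholds (R : ring_struct) n (f : rformula n) : ('I_n -> R) -> Prop :=
  match f with
  | REq _ t1 t2 => fun e => reval e t1 = reval e t2
  | RFalse _ => fun _ => False
  | RImp _ f1 f2 => fun e => rholds f1 e -> rholds f2 e
  | RForall _ f1 => fun e => forall x : R, rholds f1 (env_cons x e)
  end.

Definition rsat (R : ring_struct) (f : rsentence) : Prop :=
  forall e : 'I_0 -> R, rholds f e.

Definition rtheory := set rsentence.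

Definition rmodels (R : ring_struct) (T : rtheory) : Prop :=
  forall f, T f -> rsat R f.

Definition theory_of_finite_fields : rtheory :=
  [set f | forall R : ring_struct,
      is_field R -> finite_set [set: R] -> rsat R f].

Definition pseudo_finite (R : ring_struct) : Prop :=
  [/\ is_field R, infinite_set [set: R] & rmodels R theory_of_finite_fields].

Definition theory_of_pseudo_finite_fields : rtheory :=
  [set f | forall R : ring_struct, pseudo_finite R -> rsat R f].

(** * Lazard Lie algebras *)

(* Structures in the language of Lie algebras over [K] with unary predicates
   P_1, ..., P_{c+1}; [lpred i] with [i : 'I_c.+1] interprets P_{i+1}. *)
Record lie_struct (c : nat) (K : Type) := LieStruct {
  lcar :> Type;
  lzero : lcar;
  ladd : lcar -> lcar -> lcar;
  lsub : lcar -> lcar -> lcar;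
  lbr : lcar -> lcar -> lcar;
  lscale : K -> lcar -> lcar;
  lpred : 'I_c.+1 -> set lcar
}.
Arguments lzero {c K l}.

Section LieStructTheory.
Variables (c : nat) (R : ring_struct) (V : lie_struct c R).

Record is_vector_space : Prop := IsVectorSpace {
  vs_addA : forall x y z : V, ladd x (ladd y z) = ladd (ladd x y) z;
  vs_addC : forall x y : V, ladd x y = ladd y x;
  vs_add0 : forall x : V, ladd lzero x = x;
  vs_sub : forall x y : V, ladd (lsub x y) y = x;
  vs_scaleA : forall a b (x : V), lscale a (lscale b x) = lscale (rmul a b) x;
  vs_scale1 : forall x : V, lscale rone x = x;
  vs_scaleDr : forall a (x y : V),
    lscale a (ladd x y) = ladd (lscale a x) (lscale a y);
  vs_scaleDl : forall a b (x : V),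
    lscale (radd a b) x = ladd (lscale a x) (lscale b x)
}.

Record is_lie_bracket : Prop := IsLieBracket {
  br_alt : forall x : V, lbr x x = lzero;
  br_addl : forall x y z : V, lbr (ladd x y) z = ladd (lbr x z) (lbr y z);
  br_addr : forall x y z : V, lbr z (ladd x y) = ladd (lbr z x) (lbr z y);
  br_scalel : forall a (x y : V), lbr (lscale a x) y = lscale a (lbr x y);
  br_scaler : forall a (x y : V), lbr x (lscale a y) = lscale a (lbr x y);
  br_jacobi : forall x y z : V,
    ladd (lbr x (lbr y z)) (ladd (lbr y (lbr z x)) (lbr z (lbr x y))) = lzero
}.

Definition is_subspace (S : set V) : Prop :=
  [/\ S lzero, forall x y, S x -> S y -> S (ladd x y)
    & forall a x, S x -> S (lscale a x)].

Definition is_lie_subalgebra (S : set V) : Prop :=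
  is_subspace S /\ forall x y, S x -> S y -> S (lbr x y).

(* The term L_k of the series, for k >= 1, with L_k = 0 for k > c + 1. *)
Definition series_term (k : nat) : set V :=
  if insub k.-1 is Some i then lpred i else [set lzero].

Record is_lazard_series : Prop := IsLazardSeries {
  lz_top : series_term 1 = setT;
  lz_bot : series_term c.+1 = [set lzero];
  lz_sub : forall k, 0 < k -> is_lie_subalgebra (series_term k);
  lz_dec : forall k, 0 < k -> series_term k.+1 `<=` series_term k;
  lz_br : forall i j x y, 0 < i -> 0 < j ->
    series_term i x -> series_term j y -> series_term (i + j) (lbr x y)
}.

Definition is_LLA : Prop :=
  [/\ is_vector_space, is_lie_bracket & is_lazard_series].

Definition lincomb n (a : 'I_n -> R) (v : 'I_n -> V) : V :=
  \big[@ladd c R V / lzero]_(i < n) lscale (a i) (v i).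

Definition lin_indep n (v : 'I_n -> V) : Prop :=
  forall a : 'I_n -> R, lincomb a v = lzero -> forall i, a i = rzero.

Definition lin_span n (v : 'I_n -> V) : set V :=
  [set w | exists a : 'I_n -> R, w = lincomb a v].

Definition infinite_dimensional : Prop :=
  forall n (v : 'I_n -> V), lin_span v <> setT.

Definition subalgebra_basis n (v : 'I_n -> V) : Prop :=
  lin_indep v /\ is_lie_subalgebra (lin_span v).

End LieStructTheory.

(** * Fraisse limits *)

Section Fraisse.
Variables (c : nat) (K : Type).

Record embedding (A B : lie_struct c K) (f : A -> B) : Prop := Embedding {
  emb_inj : injective f;
  emb_zero : f lzero = lzero;
  emb_add : forall x y, f (ladd x y) = ladd (f x) (f y);
  emb_sub : forall x y, f (lsub x y) = lsub (f x) (f y);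
  emb_br : forall x y, f (lbr x y) = lbr (f x) (f y);
  emb_scale : forall a x, f (lscale a x) = lscale a (f x);
  emb_pred : forall i x, lpred i (f x) <-> lpred i x
}.

Definition automorphism (A : lie_struct c K) (f : A -> A) : Prop :=
  embedding f /\ forall y, exists x, f x = y.

Record is_substructure (A : lie_struct c K) (S : set A) : Prop :=
  IsSubstructure {
  ss_zero : S lzero;
  ss_add : forall x y, S x -> S y -> S (ladd x y);
  ss_sub : forall x y, S x -> S y -> S (lsub x y);
  ss_br : forall x y, S x -> S y -> S (lbr x y);
  ss_scale : forall a x, S x -> S (lscale a x)
}.

Definition finitely_generated (A : lie_struct c K) : Prop :=
  exists2 X : set A, finite_set X &
    forall S, is_substructure S -> X `<=` S -> S = setT.

Definition age (M A : lie_struct c K) : Prop :=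
  finitely_generated A /\ exists f : A -> M, embedding f.

(* An isomorphism between finitely generated substructures of [M] is given as
   the map f(x) |-> g(x) for two embeddings of the same structure. *)
Definition ultrahomogeneous (M : lie_struct c K) : Prop :=
  forall (A : lie_struct c K) (f g : A -> M), finitely_generated A ->
    embedding f -> embedding g ->
    exists2 h : M -> M, automorphism h & forall x, h (f x) = g x.

Definition is_fraisse_limit (C : lie_struct c K -> Prop) (M : lie_struct c K)
  : Prop :=
  [/\ countable [set: M], forall A, age M A <-> C A & ultrahomogeneous M].

End Fraisse.

Definition finite_LLA (c : nat) (R : ring_struct) (A : lie_struct c R) : Prop :=
  is_LLA A /\ finite_set [set: A].

(** * The two-sorted language and T_0 *)

(* [theta n] interprets the (n+1)-ary relation theta_{n+1}, and [pi v w i] the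
   function pi_{n,i+1} at (v_1, ..., v_n, w). *)
Record kv_struct (c : nat) := KVStruct {
  Ksort : ring_struct;
  Vsort : lie_struct c Ksort;
  theta : forall n, ('I_n.+1 -> Vsort) -> Prop;
  pi : forall n, ('I_n -> Vsort) -> Vsort -> 'I_n -> Ksort
}.
Arguments theta {c} k {n}.
Arguments pi {c} k {n}.

Record models_T0 (c : nat) (M : kv_struct c) : Prop := ModelsT0 {
  T0_field : is_field (Ksort M);
  T0_LLA : is_LLA (Vsort M);
  T0_theta : forall n (v : 'I_n.+1 -> Vsort M), theta M v <-> lin_indep v;
  T0_pi : forall n (v : 'I_n -> Vsort M) (a : 'I_n -> Ksort M),
    lin_indep v -> forall i, pi M v (lincomb a v) i = a i;
  T0_pi_default : forall n (v : 'I_n -> Vsort M) w,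
    ~ (lin_indep v /\ lin_span v w) -> forall i, pi M v w i = rzero
}.

(* The structure with sorts R and V, and theta, pi as prescribed by T_0. *)
Definition kv_of (c : nat) (R : ring_struct) (V : lie_struct c R)
  : kv_struct c :=
  @KVStruct c R V (fun n v => lin_indep v)
    (fun n v w =>
       if pselect (exists a : 'I_n -> R, lin_indep v /\ w = lincomb a v)
         is left h then sval (cid h) else fun=> rzero).

(** * Structure constants and T^+ *)

Section StructureConstants.
Variables (c : nat) (R : ring_struct) (n : nat).

(* K^n with the bilinear map [e_i, e_j] = \sum_k alpha_{i,j,k} e_k, and the
   subsets [Q i] as interpretations of the predicates. *)
Definition std_lie (alpha : 'I_n -> 'I_n -> 'I_n -> R)
    (Q : 'I_c.+1 -> set ('I_n -> R)) : lie_struct c R :=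
  @LieStruct c R ('I_n -> R) (fun=> rzero)
    (fun x y l => radd (x l) (y l))
    (fun x y l => rsub (x l) (y l))
    (fun x y l => \big[@radd R / rzero]_(i < n) \big[@radd R / rzero]_(j < n)
                    rmul (rmul (x i) (y j)) (alpha i j l))
    (fun a x l => rmul a (x l))
    Q.

Definition std_basis (i : 'I_n) : 'I_n -> R :=
  fun j => if j == i then rone else rzero.

(* The i-th set is the span of e_{s(l)}, for l < k_i ('I_n starts at 0). *)
Definition coord_series (s : 'S_n) (k : 'I_c.+1 -> nat)
  : 'I_c.+1 -> set ('I_n -> R) :=
  fun i => [set x | exists a : 'I_n -> R,
    x = (fun j => \big[@radd R / rzero]_(l < n | l < k i)
                    rmul (a l) (std_basis (s l) j))].

Definition structure_constants (alpha : 'I_n -> 'I_n -> 'I_n -> R) : Prop :=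
  exists (s : 'S_n) (k : 'I_c.+1 -> nat),
    [/\ k ord0 = n, k ord_max = 0, {homo k : i j / i <= j >-> j <= i}
      & is_LLA (std_lie alpha (coord_series s k))].

End StructureConstants.

Definition Str (c : nat) (M : kv_struct c) n (v : 'I_n -> Vsort M)
  : 'I_n -> 'I_n -> 'I_n -> Ksort M :=
  fun i j k => pi M v (lbr (v i) (v j)) k.

Definition fcat (T : Type) n m (v : 'I_n -> T) (w : 'I_m -> T)
  : 'I_(n + m) -> T :=
  fun i => match fintype.split i with inl j => v j | inr k => w k end.

(* (K^(n+m), alpha) carries some Lazard series whose trace on K^n = K^n x 0 is
   the series that P_1, ..., P_{c+1} induce on the span of v. *)
Definition lazard_compatible (c : nat) (M : kv_struct c) n m
    (v : 'I_n -> Vsort M)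
    (alpha : 'I_(n + m) -> 'I_(n + m) -> 'I_(n + m) -> Ksort M) : Prop :=
  exists Q : 'I_c.+1 -> set ('I_(n + m) -> Ksort M),
    is_LLA (std_lie alpha Q) /\
    forall i (a : 'I_n -> Ksort M),
      Q i (fcat a (fun _ : 'I_m => rzero)) <-> lpred i (lincomb a v).

(* [lazard_compatible] makes alpha an extension of the span of v as a Lazard
   Lie algebra and not merely as a Lie algebra.  It cannot be dropped: for
   c >= 2 a nonzero v in P_c is central, so the Heisenberg algebra
   [v, w_1] = w_2 does not extend the span of v inside V.  It holds whenever
   the required w exists (pull P_1, ..., P_{c+1} back along (v, w)). *)
Record models_Tplus (T : rtheory) (c : nat) (M : kv_struct c) : Prop :=
  ModelsTplus {
  Tplus_T0 : models_T0 M;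
  Tplus_field : rmodels (Ksort M) T;
  Tplus_infdim : infinite_dimensional (Vsort M);
  Tplus_realize : forall n (alpha : 'I_n -> 'I_n -> 'I_n -> Ksort M),
    structure_constants c alpha ->
    exists v : 'I_n -> Vsort M,
      subalgebra_basis v /\ forall i j k, Str v i j k = alpha i j k;
  Tplus_extend : forall n m, n < m ->
    forall (v : 'I_n -> Vsort M)
           (alpha : 'I_(n + m) -> 'I_(n + m) -> 'I_(n + m) -> Ksort M),
    subalgebra_basis v ->
    structure_constants c alpha ->
    (forall i j k : 'I_n,
        alpha (lshift m i) (lshift m j) (lshift m k) = Str v i j k) ->
    (forall (i j : 'I_n) (k : 'I_m),
        alpha (lshift m i) (lshift m j) (rshift n k) = rzero) ->
    lazard_compatible v alpha ->
    exists w : 'I_m -> Vsort M,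
      subalgebra_basis (fcat v w) /\
      forall i j k, Str (fcat v w) i j k = alpha i j k
}.

(** * Ultraproducts *)

Section UltraproductCarrier.
Variables (I : Type) (D : set_system I) (X : I -> Type).

(* Equivalence classes of equality D-almost everywhere. *)
Definition uclass (x : forall i, X i) : set (forall i, X i) :=
  [set y | D [set i | x i = y i]].

Definition uprod : Type :=
  {A : set (forall i, X i) | exists x, A = uclass x}.

Definition upi (x : forall i, X i) : uprod :=
  exist _ (uclass x) (ex_intro _ x erefl).

Definition urepr (A : uprod) : forall i, X i := sval (cid (svalP A)).

End UltraproductCarrier.

Section Ultraproduct.
Variables (I : Type) (D : set_system I) (c : nat) (M : I -> kv_struct c).

Let K := uprod D (fun i => Ksort (M i)).
Let V := uprod D (fun i => Vsort (M i)).

Definition uprod_ring : ring_struct :=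
  @RingStruct K
    (upi D (fun i => @rzero (Ksort (M i))))
    (upi D (fun i => @rone (Ksort (M i))))
    (fun x y => upi D (fun i => radd (urepr x i) (urepr y i)))
    (fun x y => upi D (fun i => rsub (urepr x i) (urepr y i)))
    (fun x y => upi D (fun i => rmul (urepr x i) (urepr y i))).

Definition uprod_lie : lie_struct c uprod_ring :=
  @LieStruct c uprod_ring V
    (upi D (fun i => @lzero c _ (Vsort (M i))))
    (fun x y => upi D (fun i => ladd (urepr x i) (urepr y i)))
    (fun x y => upi D (fun i => lsub (urepr x i) (urepr y i)))
    (fun x y => upi D (fun i => lbr (urepr x i) (urepr y i)))
    (fun (a : K) x => upi D (fun i => lscale (urepr a i) (urepr x i)))
    (fun k x => D [set i | lpred k (urepr x i)]).

Definition ultraproduct : kv_struct c :=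
  @KVStruct c uprod_ring uprod_lie
    (fun n v => D [set i | theta (M i) (fun j => urepr (v j) i)])
    (fun n v w k =>
       upi D (fun i => pi (M i) (fun j => urepr (v j) i) (urepr w i) k)).

End Ultraproduct.

Definition nonprincipal (I : Type) (D : set_system I) : Prop :=
  forall i : I, D <> principal_filter i.

Definition primes_type := {p : nat | prime p}.

Definition Fp (p : primes_type) : ring_struct := ring_struct_of 'F_(sval p).

(* Main.v *)
(**
Łoś's theorem reduces every clause of T^+ to a statement about D-almost every
L_p. At a prime p, the Lie algebra on F_p^n given by structure constants that
admit a Lazard series is a finite LLA, hence embeds into L_p, and the images of
the standard basis vectors realize the structure constants. For the extension
clause, the span of v embeds both into L_p and into the algebra B given by
alpha; composing an embedding of B into L_p with an automorphism of L_p that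
exists by ultrahomogeneity makes it extend the inclusion of the span of v.

The Lazard series witnessing that alpha is compatible with v consists of
arbitrary subspaces of K^n, K the ultraproduct of the F_p. Each of them is
spanned by n vectors, so it is the ultraproduct of subspaces of F_p^n, which
carry the compatible series down to almost every p.
*)
Require Import Defs.
From HB Require Import structures.
From mathcomp Require Import all_boot all_order all_algebra all_fingroup.
From mathcomp Require Import all_classical.

Set Implicit Arguments.
Unset Strict Implicit.
Unset Printing Implicit Defensive.
Import GRing.Theory.

(** * Transfer along an ultrafilter *)

Section Transfer.
Local Open Scope classical_set_scope.
Context (I : Type) (D : set_system I) {hD : UltraFilter D}.

(** [P'] is meant as the statement about the ultraproduct that corresponds to [P] in the factors.
    Keeping both as arbitrary propositions turns Łoś's theorem into a calculus of closure rules,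
    with no syntax for two-sorted formulas. *)
Definition los (P : I -> Prop) (P' : Prop) : Prop := P' <-> D P.

Lemma los_iff P P' Q Q' :
  (forall i, P i <-> Q i) -> (P' <-> Q') -> los Q Q' -> los P P'.
Proof.
move=> eP /propext ->; rewrite /los.
by have -> : P = Q by apply/funext => i; apply/propext.
Qed.

Lemma los_const (A : Prop) : los (fun=> A) A.
Proof.
split=> [a|/filter_ex [] //]; exact: (@filterS _ _ _ setT) (filterT).
Qed.

Lemma los_true P P' : los P P' -> (forall i, P i) -> P'.
Proof.
by move=> hP allP; apply/hP; apply: (@filterS _ _ _ setT) (filterT) => i _.
Qed.

(** Maximality of the ultrafilter enters here: unless [P] holds almost everywhere, its complement
    lies in [D], and the implication is vacuous there. *)
Lemma los_imp P P' Q Q' :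
  los P P' -> los Q Q' -> los (fun i => P i -> Q i) (P' -> Q').
Proof.
move=> hP hQ; split=> [h|h /hP DP]; last first.
  by apply/hQ; apply: filterS2 h DP => i; apply.
have [/hP/h/hQ DQ|DnP] := in_ultra_setVsetC P hD; first exact: filterS DQ.
by apply: filterS DnP => i nP /nP.
Qed.

Lemma los_and P P' Q Q' :
  los P P' -> los Q Q' -> los (fun i => P i /\ Q i) (P' /\ Q').
Proof.
move=> hP hQ; split=> [[/hP DP /hQ DQ]|DPQ]; first exact: filterI.
by split; [apply/hP|apply/hQ]; apply: filterS DPQ => i [].
Qed.

Lemma los_not P P' : los P P' -> los (fun i => ~ P i) (~ P').
Proof. by move=> hP; apply: los_imp => //; apply: los_const. Qed.

Lemma los_equiv P P' Q Q' :
  los P P' -> los Q Q' -> los (fun i => P i <-> Q i) (P' <-> Q').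
Proof. by move=> hP hQ; apply: los_and; apply: los_imp. Qed.

Lemma los_fin (T : finType) (P : I -> T -> Prop) P' :
  (forall t, los (P^~ t) (P' t)) ->
  los (fun i => forall t, P i t) (forall t, P' t).
Proof.
move=> hP; split=> [h|h t]; last by apply/hP; apply: filterS h.
have /(filter_forall _) : forall t, D (P^~ t) by move=> t; apply/hP.
by apply; exact: _.
Qed.

(* The first hypothesis makes the conjunction finite; an infinite one need not
   descend to almost every i. *)
Lemma los_nat N (P : I -> nat -> Prop) P' :
  (forall i k, P i (minn k N) -> P i k) -> (forall k, los (P^~ k) (P' k)) ->
  los (fun i => forall k, P i k) (forall k, P' k).
Proof.
move=> hN hP; split=> [h|h k]; last by apply/hP; apply: filterS h.
have : D (fun i => forall k : 'I_N.+1, P i k).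
  by apply/(@los_fin _ _ (fun k : 'I__ => P' k)) => // k; apply: hP.
apply: filterS => i Pi k; apply: hN.
have lekN : minn k N < N.+1 by rewrite ltnS geq_minr.
exact: (Pi (Ordinal lekN)).
Qed.

(** * Quantifiers and finite tuples over a presented ultraproduct *)

Section Presentations.
Variables (X : I -> Type) (X' : Type) (q : (forall i, X i) -> X').

(* X' need not be [uprod D X] itself, so that K^n is also presented as the
   ultraproduct of the powers R_i^n. *)
Record presents : Prop := Presents {
  pres_surj : forall x', exists x, x' = q x;
  pres_eq : forall x y, los (fun i => x i = y i) (q x = q y)
}.

Hypothesis hq : forall x', exists x, x' = q x.

(** If the universal statement failed almost everywhere, counterexamples chosen factor by factor
    would form one family, whose image under [q] violates [P']. *)
Lemma los_forall (x0 : forall i, X i) P P' :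
  (forall x, los (fun i => P i (x i)) (P' (q x))) ->
  los (fun i => forall x, P i x) (forall x, P' x).
Proof.
move=> hP; split=> [h|h x']; last first.
  by have [x ->] := hq x'; apply/hP; apply: filterS h => i.
have [//|DnP] := in_ultra_setVsetC (fun i => forall x, P i x) hD.
(* [x0] fills in the factors that have no counterexample. *)
pose x i :=
  if pselect (exists x, ~ P i x) is left e then sval (cid e) else x0 i.
have /hP DP := h (q x).
have [i [nPi]] := filter_ex (filterI DnP DP); rewrite /x.
case: pselect => [e|ne _]; first by case: cid.
by case: nPi => y; apply: contrapT => nPy; apply: ne; exists y.
Qed.

Lemma los_exists (x0 : forall i, X i) P P' :
  (forall x, los (fun i => P i (x i)) (P' (q x))) ->
  los (fun i => exists x, P i x) (exists x, P' x).
Proof.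
move=> hP.
apply: (@los_iff _ _ (fun i => ~ forall x, ~ P i x) (~ forall x, ~ P' x)).
- by move=> i; rewrite forallNE notK.
- by rewrite forallNE notK.
by apply: los_not; apply: los_forall => // x; apply: los_not.
Qed.

Lemma los_seteq (x0 : forall i, X i) (A B : forall i, set (X i)) A' B' :
  (forall x, los (fun i => A i (x i)) (A' (q x))) ->
  (forall x, los (fun i => B i (x i)) (B' (q x))) ->
  los (fun i => A i = B i) (A' = B').
Proof.
move=> hA hB.
apply: (@los_iff _ _ (fun i => forall x, A i x <-> B i x)
                     (forall x, A' x <-> B' x)).
- by move=> i; split=> [-> //|AB]; apply/seteqP; split=> x /AB.
- by split=> [-> //|AB]; apply/seteqP; split=> x /AB.
by apply: los_forall => // x; apply: los_equiv.
Qed.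

Definition tup n (x : forall i, 'I_n -> X i) : 'I_n -> X' :=
  fun j => q (fun i => x i j).

(** With [tup] in place of [q], the quantifier rules range over n-tuples. *)
Lemma tup_surj n (x' : 'I_n -> X') : exists x, x' = tup x.
Proof.
have [f fE] := choice (fun j => hq (x' j)).
by exists (fun i j => f j i); apply/funext.
Qed.

Lemma pres_big (op : forall i, X i -> X i -> X i) idx op' idx'
    (J : Type) (s : seq J) (P : pred J) (F : forall i, J -> X i) :
  q idx = idx' ->
  (forall x y, q (fun i => op i (x i) (y i)) = op' (q x) (q y)) ->
  q (fun i => \big[op i/idx i]_(j <- s | P j) F i j) =
  \big[op'/idx']_(j <- s | P j) q (F^~ j).
Proof.
move=> qidx qop; elim: s => [|j s IHs].
  rewrite big_nil -qidx; congr q.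
  by apply/functional_extensionality_dep => i; rewrite big_nil.
rewrite big_cons -IHs -qop; case Pj: (P j); congr q;
  by apply/functional_extensionality_dep => i; rewrite big_cons Pj.
Qed.

End Presentations.

Lemma upi_presents (X : I -> Type) : presents (upi D (X := X)).
Proof.
split=> [[A [x defA]]|x y].
  by exists x; apply: eq_exist.
split=> [xy|Dxy].
  have: uclass D y y by apply: filterS (filterT) => i.
  by rewrite -[uclass D y]/(sval (upi D y)) -xy.
apply: eq_exist; apply/seteqP; split=> z; rewrite /uclass /= => Dz.
  by apply: filterS2 Dxy Dz => i /= ->.
by apply: filterS2 Dxy Dz => i /= -> ->.
Qed.

Lemma upi_urepr (X : I -> Type) (x : uprod D X) : upi D (urepr x) = x.
Proof.
by case: x => A hA; apply: eq_exist; rewrite /urepr /=; case: cid.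
Qed.

(** The operations of the ultraproduct are defined through [urepr], whose chosen representative
    agrees with a given family only almost everywhere; this is enough to compute them pointwise. *)
Lemma urepr_upi (X : I -> Type) (x : forall i, X i) :
  D (fun i => urepr (upi D x) i = x i).
Proof. by apply/(pres_eq (upi_presents X)); rewrite upi_urepr. Qed.

End Transfer.

(** * Łoś's theorem for fields and Lazard Lie algebras *)

Section RingLos.
Local Open Scope classical_set_scope.
Context (I : Type) (D : set_system I) {hD : UltraFilter D}.
Variables (R : I -> ring_struct) (K : ring_struct) (rq : (forall i, R i) -> K).

Record ring_presents : Prop := RingPresents {
  rp_presents : presents D rq;
  rp_zero : rq (fun=> rzero) = rzero;
  rp_one : rq (fun=> rone) = rone;
  rp_add : forall x y, rq (fun i => radd (x i) (y i)) = radd (rq x) (rq y);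
  rp_sub : forall x y, rq (fun i => rsub (x i) (y i)) = rsub (rq x) (rq y);
  rp_mul : forall x y, rq (fun i => rmul (x i) (y i)) = rmul (rq x) (rq y)
}.

Hypothesis hr : ring_presents.

Let r_surj := pres_surj (rp_presents hr).
Let r_eq := pres_eq (rp_presents hr).

Let rz i : R i := rzero.

Lemma los_field :
  (forall i, is_field (R i)) -> is_field K.
Proof.
move=> fR.
split.
- by apply: (los_true _ (fun i => fld_addA (fR i)));
    do 3![apply: (los_forall r_surj rz) => ?];
    rewrite -!(rp_add hr); apply: r_eq.
- by apply: (los_true _ (fun i => fld_addC (fR i)));
    do 2![apply: (los_forall r_surj rz) => ?];
    rewrite -!(rp_add hr); apply: r_eq.
- by apply: (los_true _ (fun i => fld_add0 (fR i)));
    apply: (los_forall r_surj rz) => ?;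
    rewrite -(rp_zero hr) -!(rp_add hr); apply: r_eq.
- by apply: (los_true _ (fun i => fld_sub (fR i)));
    do 2![apply: (los_forall r_surj rz) => ?];
    rewrite -(rp_sub hr) -!(rp_add hr); apply: r_eq.
- by apply: (los_true _ (fun i => fld_mulA (fR i)));
    do 3![apply: (los_forall r_surj rz) => ?];
    rewrite -!(rp_mul hr); apply: r_eq.
- by apply: (los_true _ (fun i => fld_mulC (fR i)));
    do 2![apply: (los_forall r_surj rz) => ?];
    rewrite -!(rp_mul hr); apply: r_eq.
- by apply: (los_true _ (fun i => fld_mul1 (fR i)));
    apply: (los_forall r_surj rz) => ?;
    rewrite -(rp_one hr) -!(rp_mul hr); apply: r_eq.
- by apply: (los_true _ (fun i => fld_mulD (fR i)));
    do 3![apply: (los_forall r_surj rz) => ?];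
    rewrite -?(rp_add hr) -!(rp_mul hr) -(rp_add hr);
    apply: r_eq.
- by apply: (los_true _ (fun i => fld_one_neq0 (fR i)));
    apply: los_not; rewrite -(rp_one hr) -(rp_zero hr); apply: r_eq.
- apply: (los_true _ (fun i => fld_inv (fR i))).
  apply: (los_forall r_surj rz) => x; apply: los_imp.
    by apply: los_not; rewrite -(rp_zero hr); apply: r_eq.
  apply: (los_exists r_surj rz) => y.
  by rewrite -(rp_mul hr) -(rp_one hr); apply: r_eq.
Qed.

Lemma rp_reval n (e : forall i, 'I_n -> R i) (t : rterm n) :
  rq (fun i => reval (e i) t) = reval (tup rq e) t.
Proof.
elim: t => //= [||t <- t' <-|t <- t' <-|t <- t' <-].
- exact: (rp_zero hr).
- exact: (rp_one hr).
- by rewrite -(rp_add hr).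
- by rewrite -(rp_sub hr).
- by rewrite -(rp_mul hr).
Qed.

(** Łoś's theorem in syntactic form, required for the field sort because pseudo-finiteness
    quantifies over sentences. The Lie algebra axioms are transferred one by one instead. *)
Lemma los_rholds n (f : rformula n) (e : forall i, 'I_n -> R i) :
  los D (fun i => rholds f (e i)) (rholds f (tup rq e)).
Proof.
elim: f e => /= {n} [n t t'|n|n f IHf f' IHf'|n f IHf] e.
- by rewrite -!rp_reval; apply: r_eq.
- exact: los_const.
- exact: los_imp (IHf e) (IHf' e).
apply: (los_forall r_surj rz) => x.
have -> : env_cons (rq x) (tup rq e) =
          tup rq (fun i => env_cons (x i) (e i)).
  by apply/funext => j; rewrite /env_cons /tup; case: unlift.
exact: IHf.
Qed.

Lemma los_rsat (f : rsentence) : (forall i, rsat (R i) f) -> rsat K f.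
Proof.
move=> Rf e; have [e' ->] := tup_surj r_surj e.
by apply/los_rholds; apply: filterS (filterT) => i _; apply: Rf.
Qed.

Section Lie.
Variable c : nat.

Record lie_presents (V : forall i, lie_struct c (R i))
    (W : lie_struct c K) (q : (forall i, V i) -> W) : Prop := LiePresents {
  lp_presents : presents D q;
  lp_zero : q (fun=> lzero) = lzero;
  lp_add : forall x y, q (fun i => ladd (x i) (y i)) = ladd (q x) (q y);
  lp_sub : forall x y, q (fun i => lsub (x i) (y i)) = lsub (q x) (q y);
  lp_br : forall x y, q (fun i => lbr (x i) (y i)) = lbr (q x) (q y);
  lp_scale : forall a x, q (fun i => lscale (a i) (x i)) = lscale (rq a) (q x);
  lp_pred : forall k x, los D (fun i => lpred k (x i)) (lpred k (q x))
}.

Section LiePresentation.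
Variables (V : forall i, lie_struct c (R i)) (W : lie_struct c K).
Variable q : (forall i, V i) -> W.
Hypothesis hq : lie_presents q.

Let q_surj := pres_surj (lp_presents hq).
Let q_eq := pres_eq (lp_presents hq).
Let lz i : V i := lzero.
Let allV P P' := @los_forall _ _ hD _ _ _ q_surj lz P P'.
Let allR P P' := @los_forall _ _ hD _ _ _ r_surj rz P P'.

(** Collects each side of an equation under a single [q], innermost operations first; rules recur
    because a collected subterm exposes the operation around it. *)
Ltac los_eqn :=
  rewrite -?(rp_add hr) -?(rp_mul hr) -?(rp_one hr) -?(lp_zero hq) -?(lp_sub hq)
    -?(lp_scale hq) -?(lp_br hq) -?(lp_add hq) -?(lp_scale hq) -?(lp_br hq)
    -?(lp_add hq) -?(lp_add hq);
  exact: q_eq.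

Ltac los_univ :=
  repeat (first [apply: los_and | apply: allV => ? | apply: allR => ?]);
  los_eqn.

Lemma los_vector_space :
  los D (fun i => is_vector_space (V i)) (is_vector_space W).
Proof.
(* The transfer rules know conjunctions but not records. [E] is generic in the structure because it
   serves both the factors and the ultraproduct. *)
have E (Q : ring_struct) (U : lie_struct c Q) : is_vector_space U <->
  (forall x y z : U, ladd x (ladd y z) = ladd (ladd x y) z) /\
  (forall x y : U, ladd x y = ladd y x) /\
  (forall x : U, ladd lzero x = x) /\
  (forall x y : U, ladd (lsub x y) y = x) /\
  (forall a b (x : U), lscale a (lscale b x) = lscale (rmul a b) x) /\
  (forall x : U, lscale rone x = x) /\
  (forall a (x y : U), lscale a (ladd x y) = ladd (lscale a x) (lscale a y)) /\
  (forall a b (x : U), lscale (radd a b) x = ladd (lscale a x) (lscale b x)).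
  by split=> [[] *|]; [do !split|move=> h; decompose [and] h; split].
apply: (los_iff (fun i => E _ _) (E _ _)).
los_univ.
Qed.

Lemma los_lie_bracket :
  los D (fun i => is_lie_bracket (V i)) (is_lie_bracket W).
Proof.
have E (Q : ring_struct) (U : lie_struct c Q) : is_lie_bracket U <->
  (forall x : U, lbr x x = lzero) /\
  (forall x y z : U, lbr (ladd x y) z = ladd (lbr x z) (lbr y z)) /\
  (forall x y z : U, lbr z (ladd x y) = ladd (lbr z x) (lbr z y)) /\
  (forall a (x y : U), lbr (lscale a x) y = lscale a (lbr x y)) /\
  (forall a (x y : U), lbr x (lscale a y) = lscale a (lbr x y)) /\
  (forall x y z : U,
    ladd (lbr x (lbr y z)) (ladd (lbr y (lbr z x)) (lbr z (lbr x y))) = lzero).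
  by split=> [[] *|]; [do !split|move=> h; decompose [and] h; split].
apply: (los_iff (fun i => E _ _) (E _ _)).
los_univ.
Qed.

Lemma los_subspace (S : forall i, set (V i)) S' :
  (forall x, los D (fun i => S i (x i)) (S' (q x))) ->
  los D (fun i => is_subspace (S i)) (is_subspace S').
Proof.
move=> hS.
have E (Q : ring_struct) (U : lie_struct c Q) (T : set U) : is_subspace T <->
  T lzero /\ (forall x y, T x -> T y -> T (ladd x y)) /\
  (forall a x, T x -> T (lscale a x)).
  by split=> [[]|[? []]].
apply: (los_iff (fun i => E _ _ _) (E _ _ _)).
apply: los_and; first by rewrite -(lp_zero hq).
apply: los_and.
  apply: allV => x; apply: allV => y.
  by apply: los_imp => //; apply: los_imp => //; rewrite -(lp_add hq).
apply: allR => a; apply: allV => x.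
by apply: los_imp => //; rewrite -(lp_scale hq).
Qed.

Lemma los_lie_subalgebra (S : forall i, set (V i)) S' :
  (forall x, los D (fun i => S i (x i)) (S' (q x))) ->
  los D (fun i => is_lie_subalgebra (S i)) (is_lie_subalgebra S').
Proof.
move=> hS; apply: los_and; first exact: los_subspace.
apply: allV => x; apply: allV => y.
by apply: los_imp => //; apply: los_imp => //; rewrite -(lp_br hq).
Qed.

Lemma los_series_term k x :
  los D (fun i => @series_term c _ (V i) k (x i)) (@series_term c _ W k (q x)).
Proof.
rewrite /series_term; case: insub => [j|]; first exact: lp_pred.
by rewrite /= -(lp_zero hq); apply: q_eq.
Qed.

(** From index c+2 on, [k.-1] falls outside ['I_c.+1] and the term is zero. This bounds the
    quantifiers over indices, as [los_nat] demands. *)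
Lemma series_termE (Q : ring_struct) (U : lie_struct c Q) k :
  @series_term c _ U k = @series_term c _ U (minn k c.+2).
Proof.
case: (leqP k c.+2) => //; case: k => // k ltck.
by rewrite /series_term !insubF //= ?ltnn // ltnNge -ltnS ltnW.
Qed.

Lemma los_lazard_series :
  los D (fun i => is_lazard_series (V i)) (is_lazard_series W).
Proof.
have E (Q : ring_struct) (U : lie_struct c Q) : is_lazard_series U <->
  @series_term c _ U 1 = setT /\ @series_term c _ U c.+1 = [set lzero] /\
  (forall k, 0 < k -> is_lie_subalgebra (@series_term c _ U k)) /\
  (forall k, 0 < k -> @series_term c _ U k.+1 `<=` @series_term c _ U k) /\
  (forall i j, 0 < i -> 0 < j -> forall x y,
    @series_term c _ U i x -> @series_term c _ U j y ->
    @series_term c _ U (i + j) (lbr x y)).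
  split=> [[*]|[? [? [? [? h]]]]]; first by do !split=> //; auto.
  by split=> // i j x y i0 j0; apply: h.
have pos k : (0 < minn k c.+2) = (0 < k) by rewrite leq_min andbT.
apply: (los_iff (fun i => E _ _) (E _ _)).
apply: los_and.
  apply: (los_seteq q_surj lz) => x; first exact: los_series_term.
  exact: los_const.
apply: los_and.
  apply: (los_seteq q_surj lz) => x; first exact: los_series_term.
  by rewrite /= -(lp_zero hq); apply: q_eq.
apply: los_and.
  apply: (los_nat (N := c.+2)) => [i k|k].
    by rewrite pos -series_termE.
  apply: los_imp; first exact: los_const.
  by apply: los_lie_subalgebra => x; apply: los_series_term.
apply: los_and.
  apply: (los_nat (N := c.+2)) => [i k|k].
    rewrite pos -series_termE (@series_termE _ _ k.+1).
    rewrite (@series_termE _ _ (minn k c.+2).+1).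
    suff -> : minn (minn k c.+2).+1 c.+2 = minn k.+1 c.+2 by [].
    by rewrite -minnSS -minnA (minn_idPr (leqnSn _)).
  apply: los_imp; first exact: los_const.
  by apply: allV => x; apply: los_imp; apply: los_series_term.
(* The bracket clause has two indices; they are truncated one after the other, which affects their
   sum only beyond c+2, where the term is zero. *)
apply: (los_nat (N := c.+2)) => [i j h j' j0 j'0 x y jx j'y|j].
  rewrite (@series_termE _ _ (j + j')).
  suff -> : minn (j + j') c.+2 = minn (minn j c.+2 + j') c.+2.
    rewrite -series_termE.
    by apply: h => //; rewrite ?pos // -series_termE.
  case: (leqP j c.+2) => // ltcj; rewrite !(minn_idPr _) ?leq_addr //.
  by rewrite (leq_trans (ltnW ltcj)) ?leq_addr.
apply: (los_nat (N := c.+2)) => [i j' h j0 j'0 x y jx j'y|j'].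
  rewrite (@series_termE _ _ (j + j')).
  suff -> : minn (j + j') c.+2 = minn (j + minn j' c.+2) c.+2.
    rewrite -series_termE.
    by apply: h => //; rewrite ?pos // -series_termE.
  case: (leqP j' c.+2) => // ltcj; rewrite !(minn_idPr _) ?leq_addl //.
  by rewrite (leq_trans (ltnW ltcj)) ?leq_addl.
apply: los_imp; first exact: los_const.
apply: los_imp; first exact: los_const.
apply: allV => x; apply: allV => y.
apply: los_imp; first exact: los_series_term.
apply: los_imp; first exact: los_series_term.
by rewrite -(lp_br hq); apply: los_series_term.
Qed.

Lemma los_LLA : los D (fun i => is_LLA (V i)) (is_LLA W).
Proof.
have E (Q : ring_struct) (U : lie_struct c Q) : is_LLA U <->
  is_vector_space U /\ is_lie_bracket U /\ is_lazard_series U.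
  by split=> [[]|[? []]].
apply: (los_iff (fun i => E _ _) (E _ _)).
apply: los_and; first exact: los_vector_space.
apply: los_and; first exact: los_lie_bracket.
exact: los_lazard_series.
Qed.

Lemma lp_lincomb n (a : forall i, 'I_n -> R i) (v : forall i, 'I_n -> V i) :
  q (fun i => lincomb (a i) (v i)) = lincomb (tup rq a) (tup q v).
Proof.
rewrite /lincomb (pres_big (op' := @ladd c K W) (idx' := lzero)).
- by apply: eq_bigr => j _; rewrite (lp_scale hq (fun i => a i j)).
- exact: lp_zero.
- exact: lp_add.
Qed.

Let tupR n := @tup_surj _ _ _ _ r_surj n.

Lemma los_lin_indep n (v : forall i, 'I_n -> V i) :
  los D (fun i => lin_indep (v i)) (lin_indep (tup q v)).
Proof.
apply: (los_forall (@tupR n) (fun i _ => rzero)) => a.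
apply: los_imp; first by rewrite -lp_lincomb -(lp_zero hq); apply: q_eq.
by apply: los_fin => k; rewrite -(rp_zero hr); apply: r_eq.
Qed.

Lemma los_lin_span n (v : forall i, 'I_n -> V i) (w : forall i, V i) :
  los D (fun i => lin_span (v i) (w i)) (lin_span (tup q v) (q w)).
Proof.
apply: (los_exists (@tupR n) (fun i _ => rzero)) => a.
by rewrite -lp_lincomb; apply: q_eq.
Qed.

(** Only an implication: spaces whose finite dimensions are unbounded along [D] also have an
    infinite-dimensional ultraproduct. For a fixed number of vectors, not spanning does transfer. *)
Lemma los_infinite_dimensional :
  (forall i, infinite_dimensional (V i)) -> infinite_dimensional W.
Proof.
move=> infV n v'; have [v ->] := tup_surj q_surj v'.
apply: (los_true _ (fun i => infV i n (v i))); apply: los_not.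
apply: (los_seteq q_surj lz) => x; first exact: los_lin_span.
exact: los_const.
Qed.

End LiePresentation.

End Lie.
End RingLos.

(** * The canonical presentations of the two sorts of an ultraproduct *)

Section Ultraproduct.
Local Open Scope classical_set_scope.
Context (I : Type) (D : set_system I) {hD : UltraFilter D}.
Variables (R : I -> ring_struct).

Let K := uprod D (fun i => R i).

(* [ring_uprod] and [lie_uprod] are convertible to the sorts of [ultraproduct]
   at [fun i => kv_of (V i)], whose rings depend on the Lie algebras V i. *)
Definition ring_uprod : ring_struct :=
  @RingStruct K
    (upi D (fun i => @rzero (R i)))
    (upi D (fun i => @rone (R i)))
    (fun x y => upi D (fun i => radd (urepr x i) (urepr y i)))
    (fun x y => upi D (fun i => rsub (urepr x i) (urepr y i)))
    (fun x y => upi D (fun i => rmul (urepr x i) (urepr y i))).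

Definition rupi (x : forall i, R i) : ring_uprod := upi D x.

Lemma ring_uprod_presents : ring_presents D rupi.
Proof.
have upi_eq (x y : forall i, R i) := pres_eq (upi_presents (fun i => R i)) x y.
split=> //; first exact: upi_presents.
- by move=> x y; apply/upi_eq;
    apply: filterS2 (urepr_upi x) (urepr_upi y) => i -> ->.
- by move=> x y; apply/upi_eq;
    apply: filterS2 (urepr_upi x) (urepr_upi y) => i -> ->.
- by move=> x y; apply/upi_eq;
    apply: filterS2 (urepr_upi x) (urepr_upi y) => i -> ->.
Qed.

Variables (c : nat) (V : forall i, lie_struct c (R i)).

Definition lie_uprod :
    lie_struct c ring_uprod :=
  @LieStruct c ring_uprod (uprod D (fun i => V i))
    (upi D (fun i => @lzero c _ (V i)))
    (fun x y => upi D (fun i => ladd (urepr x i) (urepr y i)))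
    (fun x y => upi D (fun i => lsub (urepr x i) (urepr y i)))
    (fun x y => upi D (fun i => lbr (urepr x i) (urepr y i)))
    (fun (a : K) x => upi D (fun i => lscale (urepr a i) (urepr x i)))
    (fun k x => D [set i | lpred k (urepr x i)]).

Definition lupi (x : forall i, V i) :
  lie_uprod := upi D x.

Lemma lie_uprod_presents : lie_presents D rupi lupi.
Proof.
have upi_eq (x y : forall i, V i) := pres_eq (upi_presents (fun i => V i)) x y.
split=> //; first exact: upi_presents.
- by move=> x y; apply/upi_eq;
    apply: filterS2 (urepr_upi x) (urepr_upi y) => i -> ->.
- by move=> x y; apply/upi_eq;
    apply: filterS2 (urepr_upi x) (urepr_upi y) => i -> ->.
- by move=> x y; apply/upi_eq;
    apply: filterS2 (urepr_upi x) (urepr_upi y) => i -> ->.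
- by move=> a x; apply/upi_eq;
    apply: filterS2 (urepr_upi a) (urepr_upi x) => i -> ->.
move=> k x; split; apply: filterS2 (urepr_upi x) => i.
  by move=> /= ->.
by move=> /= ->.
Qed.

End Ultraproduct.

(** * Linear algebra over abstract fields *)

Section FieldOf.
Variables (R : ring_struct) (hR : is_field R).

(** The proof occurs in the type so that the algebraic instances attached to the carrier can depend
    on it. *)
Definition field_of of is_field R : Type := R.
Local Notation F := (field_of hR).

HB.instance Definition _ := gen_eqMixin F.
HB.instance Definition _ := gen_choiceMixin F.

Let addNr : left_inverse rzero (fun x : F => rsub rzero x) (@radd R).
Proof. by move=> x; rewrite (fld_sub hR). Qed.

HB.instance Definition _ :=
  GRing.isZmodule.Build F (fld_addA hR) (fld_addC hR) (fld_add0 hR) addNr.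

Let mulDl : left_distributive (@rmul R) (@radd R).
Proof. by move=> x y z; rewrite !(fld_mulC hR _ z) (fld_mulD hR). Qed.

Let one_neq0 : (rone : F) != rzero.
Proof. by apply/eqP; apply: fld_one_neq0. Qed.

HB.instance Definition _ :=
  GRing.Zmodule_isComNzRing.Build F (fld_mulA hR) (fld_mulC hR) (fld_mul1 hR)
    mulDl one_neq0.

(** The second conjunct fixes the inverse of 0 as 0, the convention of MathComp fields. *)
Let inv_spec (x : F) :
  exists y, (x != 0%R -> y * x = 1)%R /\ (x = 0%R -> y = 0%R).
Proof.
have [->|x0] := eqVneq x 0%R; first by exists 0%R.
have [y yx] := fld_inv hR (elimN eqP x0).
by exists y; split=> [//|xE]; rewrite xE eqxx in x0.
Qed.

Let inv (x : F) : F := sval (cid (inv_spec x)).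

Let mulVf (x : F) : (x != 0 -> inv x * x = 1)%R.
Proof. by move=> x0; rewrite /inv; case: cid => y /= h; apply: (proj1 h). Qed.

Let invr0 : inv 0%R = 0%R.
Proof. by rewrite /inv; case: cid => y /= h; apply: (proj2 h). Qed.

HB.instance Definition _ := GRing.ComNzRing_isField.Build F mulVf invr0.

(** An equality and not just an isomorphism: after [subst], MathComp's linear algebra applies to the
    abstract field directly. *)
Lemma is_field_ring_struct_of : exists F : fieldType, R = ring_struct_of F.
Proof.
exists F; rewrite /ring_struct_of.
transitivity (@RingStruct R rzero rone (@radd R) (@rsub R) (@rmul R)).
  by case: (R).
(* Subtraction is the one operation that MathComp derives, from addition and opposite, so it alone
   needs an argument. *)
have -> : (fun x y : F => (x - y)%R) = @rsub R.
  by apply/funext => x; apply/funext => y; apply: (canLR (@addrK F y));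
     apply/esym/(fld_sub hR).
by [].
Qed.

End FieldOf.

Lemma ring_struct_of_field (F : fieldType) : is_field (ring_struct_of F).
Proof.
split=> /=.
- exact: GRing.addrA.
- exact: GRing.addrC.
- exact: GRing.add0r.
- by move=> x y; rewrite GRing.subrK.
- exact: GRing.mulrA.
- exact: GRing.mulrC.
- exact: GRing.mul1r.
- exact: GRing.mulrDr.
- exact/eqP/GRing.oner_neq0.
- by move=> x /eqP x0; exists x^-1%R; apply: GRing.mulVf.
Qed.

Definition lmod_lie (c : nat) (F : fieldType) (L : lmodType F)
    (br : L -> L -> L) (P : 'I_c.+1 -> set L) :
    lie_struct c (ring_struct_of F) :=
  @LieStruct c (ring_struct_of F) L 0%R (fun x y => x + y)%R
    (fun x y => x - y)%R br (fun a x => a *: x)%R P.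

Section LmodOf.
Variables (c : nat) (F : fieldType) (V : lie_struct c (ring_struct_of F)).
Hypothesis hV : is_vector_space V.

Definition lmod_of of is_vector_space V : Type := V.
Local Notation L := (lmod_of hV).

HB.instance Definition _ := gen_eqMixin L.
HB.instance Definition _ := gen_choiceMixin L.

Let addNr : left_inverse lzero (fun x : L => lsub lzero x) (@ladd c _ V).
Proof. by move=> x; rewrite (vs_sub hV). Qed.

HB.instance Definition _ :=
  GRing.isZmodule.Build L (vs_addA hV) (vs_addC hV) (vs_add0 hV) addNr.

HB.instance Definition _ :=
  @GRing.Zmodule_isLmodule.Build F L (@lscale c F V)
    (vs_scaleA hV) (vs_scale1 hV) (vs_scaleDr hV)
    (fun x a b => vs_scaleDl hV a b x).

(** The same device for the vector sort; bracket and predicates are carried along unconstrained. *)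
Lemma is_vector_space_lmod :
  exists (L : lmodType F) (br : L -> L -> L) (P : 'I_c.+1 -> set L),
    V = lmod_lie br P.
Proof.
exists L, (@lbr c _ V), (@lpred c _ V); rewrite /lmod_lie.
transitivity (@LieStruct c _ V lzero (@ladd c _ V) (@lsub c _ V) (@lbr c _ V)
  (@lscale c _ V) (@lpred c _ V)); first by case: (V).
have -> : (fun x y : L => (x - y)%R) = @lsub c _ V.
  by apply/funext => x; apply/funext => y; apply: (canLR (@addrK L y));
     apply/esym/(vs_sub hV).
by [].
Qed.

End LmodOf.

(** * Realizations of structure constants as embeddings of K^n *)

Section Realization.
Local Open Scope ring_scope.
Variables (c : nat) (F : fieldType).
Local Notation K := (ring_struct_of F).

(** Over models of T_0 this amounts to [subalgebra_basis v] with [Str v] equal to [alpha]. It avoids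
    the coordinate functions, so it makes sense in any Lie structure and transfers easily. *)
Definition realizes (R : ring_struct) (V : lie_struct c R) n (v : 'I_n -> V)
    (alpha : 'I_n -> 'I_n -> 'I_n -> R) : Prop :=
  lin_indep v /\ forall i j, lbr (v i) (v j) = lincomb (alpha i j) v.

Lemma std_basis_lincomb n (alpha : 'I_n -> 'I_n -> 'I_n -> K) Q
    (x : 'I_n -> K) :
  x = lincomb (x : _ -> K) (fun i => std_basis K i : @std_lie c K n alpha Q).
Proof.
apply/funext => j; rewrite /lincomb.
have -> : (\big[@ladd c K (std_lie alpha Q)/lzero]_(i < n)
    lscale (x i) (std_basis K i : std_lie alpha Q)) j =
  \sum_(i < n) x i * (if j == i then 1 else 0).
  by apply: (big_morph (fun f : 'I_n -> F => f j)).
rewrite (bigD1 j) //= eqxx mulr1 big1 ?addr0 // => i /negPf.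
by rewrite eq_sym => ->; rewrite mulr0.
Qed.

Lemma lincomb_std_basis (V : lie_struct c K) n (v : 'I_n -> V) k :
  is_vector_space V -> lincomb (std_basis K k) v = v k.
Proof.
move=> /is_vector_space_lmod [L [br [P defV]]]; subst V.
transitivity (\sum_i (if i == k then 1 else 0) *: (v i : L)) => //.
rewrite (bigD1 k) //= eqxx scale1r big1 ?addr0 // => i /negPf ->.
by rewrite scale0r.
Qed.

Lemma std_basis_br n (alpha : 'I_n -> 'I_n -> 'I_n -> K) Q i j :
  lbr (std_basis K i : @std_lie c K n alpha Q) (std_basis K j) = alpha i j.
Proof.
apply/funext => l; rewrite /=.
transitivity (\sum_(i' < n) \sum_(j' < n)
   ((if i' == i then 1 else 0) * (if j' == j then 1 else 0)) *
   alpha i' j' l : F).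
  by [].
rewrite (bigD1 i) //= [X in _ + X]big1 ?addr0; last first.
  by move=> i' /negPf ->; rewrite big1 // => j' _; rewrite !mul0r.
rewrite (bigD1 j) //= big1 ?addr0; last first.
  by move=> j' /negPf ->; rewrite mulr0 mul0r.
by rewrite !eqxx !mul1r.
Qed.

Lemma embedding_lincomb (V W : lie_struct c K) (f : V -> W) n
    (a : 'I_n -> K) (v : 'I_n -> V) :
  embedding f -> f (lincomb a v) = lincomb a (f \o v).
Proof.
move=> ef; rewrite /lincomb (big_morph f (emb_add ef) (emb_zero ef)).
by apply: eq_bigr => i _; rewrite (emb_scale ef).
Qed.

Lemma embedding_realizes (V : lie_struct c K) n
    (alpha : 'I_n -> 'I_n -> 'I_n -> K) Q (f : std_lie alpha Q -> V) :
  embedding f -> realizes (fun i => f (std_basis K i)) alpha.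
Proof.
move=> ef; split=> [a|i j].
  rewrite -(embedding_lincomb a (fun i => std_basis K i : std_lie alpha Q)) //.
  rewrite -std_basis_lincomb -(emb_zero ef) => /(emb_inj ef) -> //.
rewrite -(emb_br ef) std_basis_br {1}[alpha i j](std_basis_lincomb alpha Q).
by rewrite embedding_lincomb.
Qed.

Section Lmod.
Variables (L : lmodType F) (br : L -> L -> L) (P : 'I_c.+1 -> set L).
Local Notation V := (lmod_lie br P).
Hypothesis hV : is_lie_bracket V.

Lemma br_sumZ n m (a : 'I_n -> F) (b : 'I_m -> F) (v : 'I_n -> L)
    (w : 'I_m -> L) :
  br (\sum_i a i *: v i) (\sum_j b j *: w j) =
  \sum_i \sum_j (a i * b j) *: br (v i) (w j).
Proof.
have br0l y : br 0 y = 0.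
  apply: (@addrI _ (br 0 y)); rewrite addr0.
  by rewrite -[LHS](br_addl hV) /= addr0.
have br0r y : br y 0 = 0.
  apply: (@addrI _ (br y 0)); rewrite addr0.
  by rewrite -[LHS](br_addr hV) /= addr0.
rewrite (big_morph (br^~ _) (fun x y => br_addl hV x y _) (br0l _)).
apply: eq_bigr => i _.
rewrite (big_morph (br _) (fun x y => br_addr hV x y _) (br0r _)).
apply: eq_bigr => j _.
by rewrite [LHS](br_scalel hV) /= [X in _ *: X](br_scaler hV) /= scalerA.
Qed.

(** The predicates on F^n are pulled back along the coordinate map, so compatibility with them is
    built in. Injectivity is independence of [v]; the bracket is preserved by bilinearity and the
    relations between the v_i. *)
Lemma lmod_realizes_embedding n (v : 'I_n -> V) alpha : realizes v alpha ->
  embedding (fun a : std_lie alpha (fun k a => lpred k (lincomb a v)) =>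
    lincomb (a : _ -> K) v).
Proof.
move=> [indep brv].
have add x y : \sum_i (x i + y i) *: (v i : L) =
    \sum_i x i *: (v i : L) + \sum_i y i *: (v i : L).
  by rewrite -big_split; apply: eq_bigr => i _; rewrite scalerDl.
have sub x y : \sum_i (x i - y i) *: (v i : L) =
    \sum_i x i *: (v i : L) - \sum_i y i *: (v i : L).
  by rewrite -sumrB; apply: eq_bigr => i _; rewrite scalerBl.
split=> //.
- move=> x y exy; apply/funext => i; apply/eqP; rewrite -subr_eq0; apply/eqP.
  apply: (indep (fun i => x i - y i)).
  by apply: etrans (sub x y) _; apply/eqP; rewrite subr_eq0; apply/eqP.
- transitivity (\sum_i 0 *: (v i : L)) => //.
  by apply: big1 => i _; apply: scale0r.
- move=> x y; apply: etrans (esym (br_sumZ _ _ _ _)).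
  transitivity
    (\sum_l (\sum_i \sum_j x i * y j * alpha i j l) *: (v l : L)) => //.
  (* Exchanging sums moves the sum over [l] innermost, where it becomes the bracket of v_i and
     v_j. *)
  under eq_bigr do rewrite scaler_suml.
  rewrite exchange_big; apply: eq_bigr => i _.
  under eq_bigr do rewrite scaler_suml.
  rewrite exchange_big; apply: eq_bigr => j _.
  rewrite [br _ _](brv i j).
  transitivity (x i * y j *: (\sum_l alpha i j l *: (v l : L))) => //.
  by rewrite scaler_sumr; apply: eq_bigr => l _; rewrite scalerA.
- move=> a x; transitivity (a *: (\sum_i x i *: (v i : L))) => //.
  by rewrite scaler_sumr; apply: eq_bigr => l _; rewrite scalerA.
Qed.

End Lmod.

Lemma realizes_embedding (V : lie_struct c K) n (v : 'I_n -> V) alpha :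
  is_LLA V -> realizes v alpha ->
  embedding (fun a : std_lie alpha (fun k a => lpred k (lincomb a v)) =>
    lincomb (a : _ -> K) v).
Proof.
move=> [vV + _]; have [L [br [P defV]]] := is_vector_space_lmod vV.
by subst V => bV; apply: lmod_realizes_embedding.
Qed.

(** The span is the image of an embedding, hence closed under the operations. *)
Lemma realizes_subalgebra_basis (V : lie_struct c K) n (v : 'I_n -> V) alpha :
  is_LLA V -> realizes v alpha -> subalgebra_basis v.
Proof.
move=> VLLA rv; have ev := realizes_embedding VLLA rv.
have [indep _] := rv.
split=> //; split; first split.
- by exists (fun=> 0); rewrite -(emb_zero ev).
- move=> _ _ [a ->] [b ->]; exists (fun l => a l + b l).
  by rewrite -(emb_add ev).
- move=> x _ [a ->]; exists (fun l => x * a l).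
  by rewrite -(emb_scale ev).
move=> _ _ [a ->] [b ->].
by rewrite -(emb_br ev); eexists.
Qed.

End Realization.

(** * Fraïssé limits of finite Lazard Lie algebras *)

Section GeneratedSubstructure.
Local Open Scope classical_set_scope.
Variables (c : nat) (K : Type) (M : lie_struct c K).

Section Induced.
Variables (S : set M) (hS : is_substructure S).

Definition induced : lie_struct c K :=
  @LieStruct c K {x : M | S x}
    (exist S _ (ss_zero hS))
    (fun x y => exist S _ (ss_add hS (svalP x) (svalP y)))
    (fun x y => exist S _ (ss_sub hS (svalP x) (svalP y)))
    (fun x y => exist S _ (ss_br hS (svalP x) (svalP y)))
    (fun a x => exist S _ (ss_scale hS a (svalP x)))
    (fun i x => lpred i (sval x)).

Definition induced_val (x : induced) : M := sval x.

Lemma induced_val_embedding : embedding induced_val.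
Proof. by split=> //; move=> [x hx] [y hy] /= xy; apply: eq_exist. Qed.

End Induced.

Definition generated (X : set M) : set M :=
  [set x | forall S, is_substructure S -> X `<=` S -> S x].

Lemma generated_substructure X : is_substructure (generated X).
Proof.
split.
- by move=> S hS _; apply: ss_zero.
- by move=> x y hx hy S hS XS; apply: ss_add (hx S hS XS) (hy S hS XS).
- by move=> x y hx hy S hS XS; apply: ss_sub (hx S hS XS) (hy S hS XS).
- by move=> x y hx hy S hS XS; apply: ss_br (hx S hS XS) (hy S hS XS).
- by move=> a x hx S hS XS; apply: ss_scale (hx S hS XS).
Qed.

Lemma age_generated X : finite_set X ->
  age M (induced (generated_substructure X)).
Proof.
move=> finX; split; last first.
  by exists (@induced_val _ _); apply: induced_val_embedding.
have e := induced_val_embedding (generated_substructure X).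
exists (@induced_val _ (generated_substructure X) @^-1` X).
  by apply: finite_preimage => // x y _ _; apply: (emb_inj e).
move=> S hS XS; apply/seteqP; split=> // -[x hx] _.
(* A substructure of the generated structure is pushed forward into [M], where minimality of
   [generated X] applies. *)
pose S' := [set y | exists2 z, S z & induced_val z = y].
have hS' : is_substructure S'.
  split.
  - by exists lzero => //; apply: (ss_zero hS).
  - by move=> _ _ [y Sy <-] [z Sz <-];
      exists (ladd y z) => //; apply: (ss_add hS).
  - by move=> _ _ [y Sy <-] [z Sz <-];
      exists (lsub y z) => //; apply: (ss_sub hS).
  - by move=> _ _ [y Sy <-] [z Sz <-];
      exists (lbr y z) => //; apply: (ss_br hS).
  - by move=> a _ [y Sy <-]; exists (lscale a y) => //; apply: (ss_scale hS).
have XS' : X `<=` S'.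
  move=> y Xy; have hy : generated X y by move=> T _; apply.
  by exists (exist _ y hy) => //; apply: XS.
have [z Sz zx] := hx S' hS' XS'.
suff -> : exist _ x hx = z by [].
by apply: (emb_inj e).
Qed.

Lemma generated_sub X : X `<=` generated X.
Proof. by move=> x Xx S _; apply. Qed.

End GeneratedSubstructure.

(** * Fraïssé limits of finite Lazard Lie algebras satisfy the axioms *)

Section LocallyLLA.
Local Open Scope classical_set_scope.
Variables (c : nat) (R : ring_struct).

Lemma emb_series_term (A M : lie_struct c R) (f : A -> M) k x : embedding f ->
  @series_term c R M k (f x) <-> @series_term c R A k x.
Proof.
move=> ef; rewrite /series_term; case: insub => [i|]; first exact: emb_pred.
by rewrite /= -(emb_zero ef); split=> [/(emb_inj ef)|->].
Qed.

(** Each axiom concerns at most three elements at a time, so it can be checked in an embedded LLA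
    that contains them. *)
Lemma locally_LLA (M : lie_struct c R) :
  (forall X : set M, finite_set X -> exists (A : lie_struct c R) (f : A -> M),
    [/\ embedding f, is_LLA A & X `<=` range f]) -> is_LLA M.
Proof.
move=> loc.
have {}loc x y z : exists (A : lie_struct c R) (f : A -> M) x' y' z',
    [/\ embedding f, is_LLA A & [/\ x = f x', y = f y' & z = f z']].
  have [|A [f [ef lA hf]]] := loc [set x; y; z].
    by rewrite !finite_setU; do !split; apply: finite_set1.
  have [x' _ <-] : range f x by apply: hf; left; left.
  have [y' _ <-] : range f y by apply: hf; left; right.
  have [z' _ <-] : range f z by apply: hf; right.
  by exists A, f, x', y', z'.
split; split.
- move=> x y z; have [A [f [x' [y' [z' [e [h _ _] [-> -> ->]]]]]]] := loc x y z.
  by rewrite -!(emb_add e) (vs_addA h).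
- move=> x y; have [A [f [x' [y' [z' [e [h _ _] [-> -> _]]]]]]] := loc x y x.
  by rewrite -!(emb_add e) (vs_addC h).
- move=> x; have [A [f [x' [y' [z' [e [h _ _] [-> _ _]]]]]]] := loc x x x.
  by rewrite -(emb_zero e) -!(emb_add e) (vs_add0 h).
- move=> x y; have [A [f [x' [y' [z' [e [h _ _] [-> -> _]]]]]]] := loc x y x.
  by rewrite -(emb_sub e) -!(emb_add e) (vs_sub h).
- move=> a b x; have [A [f [x' [y' [z' [e [h _ _] [-> _ _]]]]]]] := loc x x x.
  by rewrite -!(emb_scale e) (vs_scaleA h).
- move=> x; have [A [f [x' [y' [z' [e [h _ _] [-> _ _]]]]]]] := loc x x x.
  by rewrite -!(emb_scale e) (vs_scale1 h).
- move=> a x y; have [A [f [x' [y' [z' [e [h _ _] [-> -> _]]]]]]] := loc x y x.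
  by rewrite -?(emb_add e) -!(emb_scale e) -(emb_add e) (vs_scaleDr h).
- move=> a b x; have [A [f [x' [y' [z' [e [h _ _] [-> _ _]]]]]]] := loc x x x.
  by rewrite -!(emb_scale e) -(emb_add e) (vs_scaleDl h).
- move=> x; have [A [f [x' [y' [z' [e [_ h _] [-> _ _]]]]]]] := loc x x x.
  by rewrite -(emb_zero e) -!(emb_br e) (br_alt h).
- move=> x y z; have [A [f [x' [y' [z' [e [_ h _] [-> -> ->]]]]]]] := loc x y z.
  by rewrite -(emb_add e) -!(emb_br e) -(emb_add e) (br_addl h).
- move=> x y z; have [A [f [x' [y' [z' [e [_ h _] [-> -> ->]]]]]]] := loc x y z.
  by rewrite -(emb_add e) -!(emb_br e) -(emb_add e) (br_addr h).
- move=> a x y; have [A [f [x' [y' [z' [e [_ h _] [-> -> _]]]]]]] := loc x y x.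
  by rewrite -(emb_scale e) -!(emb_br e) -(emb_scale e) (br_scalel h).
- move=> a x y; have [A [f [x' [y' [z' [e [_ h _] [-> -> _]]]]]]] := loc x y x.
  by rewrite -(emb_scale e) -!(emb_br e) -(emb_scale e) (br_scaler h).
- move=> x y z; have [A [f [x' [y' [z' [e [_ h _] [-> -> ->]]]]]]] := loc x y z.
  by rewrite -!(emb_br e) -!(emb_add e) -(emb_zero e) (br_jacobi h).
- apply/seteqP; split=> // x _.
  have [A [f [x' [y' [z' [e [_ _ h] [-> _ _]]]]]]] := loc x x x.
  by apply/(emb_series_term _ _ e); rewrite (lz_top h).
- apply/seteqP; split=> x;
    have [A [f [x' [y' [z' [e [_ _ h] [-> _ _]]]]]]] := loc x x x.
    move/(emb_series_term _ _ e); rewrite (lz_bot h) /= => ->.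
    exact: emb_zero.
  rewrite /= -(emb_zero e) => /(emb_inj e) ->.
  by apply/(emb_series_term _ _ e); rewrite (lz_bot h).
- move=> k k0; split; first split.
  + have [A [f [x' [y' [z' [e [_ _ h] _]]]]]] := loc lzero lzero lzero.
    rewrite -(emb_zero e); apply/(emb_series_term _ _ e).
    by have [[]] := lz_sub h k0.
  + move=> x y; have [A [f [x' [y' [z' [e [_ _ h] [-> -> _]]]]]]] := loc x y x.
    move/(emb_series_term _ _ e) => kx /(emb_series_term _ _ e) ky.
    rewrite -(emb_add e); apply/(emb_series_term _ _ e).
    by have [[_ + _] _] := lz_sub h k0; apply.
  + move=> a x; have [A [f [x' [y' [z' [e [_ _ h] [-> _ _]]]]]]] := loc x x x.
    move/(emb_series_term _ _ e) => kx.
    rewrite -(emb_scale e); apply/(emb_series_term _ _ e).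
    by have [[_ _ +] _] := lz_sub h k0; apply.
  move=> x y; have [A [f [x' [y' [z' [e [_ _ h] [-> -> _]]]]]]] := loc x y x.
  move/(emb_series_term _ _ e) => kx /(emb_series_term _ _ e) ky.
  rewrite -(emb_br e); apply/(emb_series_term _ _ e).
  by have [_ +] := lz_sub h k0; apply.
- move=> k k0 x; have [A [f [x' [y' [z' [e [_ _ h] [-> _ _]]]]]]] := loc x x x.
  move/(emb_series_term _ _ e) => kx; apply/(emb_series_term _ _ e).
  exact: (lz_dec h k0).
move=> i j x y i0 j0.
have [A [f [x' [y' [z' [e [_ _ h] [-> -> _]]]]]]] := loc x y x.
move/(emb_series_term _ _ e) => ix /(emb_series_term _ _ e) jy.
by rewrite -(emb_br e); apply/(emb_series_term _ _ e); apply: (lz_br h).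
Qed.

(** A finitely generated substructure of [M] belongs to the age, hence is a finite LLA. *)
Lemma fraisse_limit_LLA (M : lie_struct c R) :
  is_fraisse_limit (@finite_LLA c R) M -> is_LLA M.
Proof.
move=> [_ ageM _]; apply: locally_LLA => X finX.
exists (induced (generated_substructure X)), (@induced_val _ _ _ _ _); split.
- exact: induced_val_embedding.
- by have /ageM [] := age_generated finX.
by move=> x Xx; exists (exist _ x (generated_sub Xx)).
Qed.

End LocallyLLA.

Lemma embedding_comp (c : nat) (K : Type) (A B C : lie_struct c K)
    (g : B -> C) (f : A -> B) :
  embedding g -> embedding f -> embedding (g \o f).
Proof.
move=> eg ef; split=> [||x y|x y|x y|a x|i x] /=.
- exact: inj_comp (emb_inj eg) (emb_inj ef).
- by rewrite (emb_zero ef) (emb_zero eg).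
- by rewrite (emb_add ef) (emb_add eg).
- by rewrite (emb_sub ef) (emb_sub eg).
- by rewrite (emb_br ef) (emb_br eg).
- by rewrite (emb_scale ef) (emb_scale eg).
by apply: iff_trans (emb_pred eg _ _) (emb_pred ef _ _).
Qed.

(** Supplies LLAs of every finite dimension, which make the Fraïssé limit infinite-dimensional. The
    series drops to zero right after L_1, and [0 < c] keeps L_1 apart from the zero term L_{c+1}. *)
Lemma abelian_LLA c (F : fieldType) n : 0 < c ->
  is_LLA (@std_lie c (ring_struct_of F) n (fun _ _ _ => rzero)
    (fun i x => i = ord0 \/ x = fun=> rzero)).
Proof.
move=> c0; set V := std_lie _ _.
have br0 (x y : V) : lbr x y = lzero.
  apply/funext => l /=.
  apply: (@big1 F _ +%R%R) => i _; apply: (@big1 F _ +%R%R) => j _.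
  exact: GRing.mulr0.
have serE k x : 0 < k -> @series_term c _ V k x <-> k = 1 \/ x = lzero.
  move=> k0; rewrite /series_term; case: insubP => [i ic iE|] /=.
    by split=> -[h|]; [left|right|left|right] => //;
      [rewrite -(prednK k0) -iE h|apply: val_inj; rewrite /= iE h].
  rewrite -leqNgt => ck; split=> [->|[k1|//]]; first by right.
  by rewrite k1 in ck.
have vV : is_vector_space V.
  split.
  - by move=> x y z; apply/funext => i; apply: GRing.addrA.
  - by move=> x y; apply/funext => i; apply: GRing.addrC.
  - by move=> x; apply/funext => i; apply: GRing.add0r.
  - by move=> x y; apply/funext => i; apply: GRing.subrK.
  - by move=> a b x; apply/funext => i; apply: GRing.mulrA.
  - by move=> x; apply/funext => i; apply: GRing.mul1r.
  - by move=> a x y; apply/funext => i; apply: GRing.mulrDr.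
  - by move=> a b x; apply/funext => i; apply: GRing.mulrDl.
have scale0 a : lscale a lzero = lzero :> V.
  by apply/funext => i; apply: GRing.mulr0.
have ser0 k : 0 < k -> @series_term c _ V k lzero.
  by move=> k0; apply/serE => //; right.
split=> //; split.
- by move=> x; apply: br0.
- by move=> x y z; rewrite !br0 (vs_add0 vV).
- by move=> x y z; rewrite !br0 (vs_add0 vV).
- by move=> a x y; rewrite !br0 scale0.
- by move=> a x y; rewrite !br0 scale0.
- by move=> x y z; rewrite !br0 !(vs_add0 vV).
- by apply/seteqP; split=> // x _; apply/serE => //; left.
- apply/seteqP; split=> [x /serE-/(_ isT) [[c00]|//]|x ->]; last exact: ser0.
  by rewrite c00 in c0.
- move=> k k0; split; last by move=> x y _ _; rewrite br0; apply: ser0.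
  split; first exact: ser0.
    move=> x y /serE -/(_ k0) [k1 _|->]; first by apply/serE => //; left.
    by rewrite (vs_add0 vV).
  move=> a x /serE -/(_ k0) [k1|->]; first by apply/serE => //; left.
  by rewrite scale0; apply: ser0.
- move=> k k0 x /serE-/(_ isT) [[kE]|->]; last exact: ser0.
  by rewrite kE in k0.
- move=> i j x y i0 j0 _ _; rewrite br0; apply: ser0.
  by rewrite addn_gt0 i0.
Qed.

(** The coefficients would form a matrix with n+1 rows and n columns; a nonzero vector of its left
    kernel is a linear relation among the [w i]. *)
Lemma lin_indep_span c (F : fieldType) (V : lie_struct c (ring_struct_of F)) n
    (w : 'I_n.+1 -> V) (v : 'I_n -> V) :
  is_vector_space V -> lin_indep w -> ~ forall i, lin_span v (w i).
Proof.
move=> /is_vector_space_lmod [L [br [P defV]]]; subst V.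
move=> indep /choice [a aE].
pose A : 'M[F]_(n.+1, n) := (\matrix_(i, j) a i j)%R.
have /rowV0Pn [u /sub_kermxP uA /eqP[]] : kermx A != 0%R.
  by rewrite -mxrank_eq0 mxrank_ker subn_eq0 -ltnNge ltnS rank_leq_col.
apply/rowP => i; rewrite mxE; apply: (indep (u ord0)).
transitivity (\sum_i u ord0 i *: (\sum_j a i j *: (v j : L)))%R.
  by apply: eq_bigr => k _; rewrite [w k]aE.
under eq_bigr do rewrite scaler_sumr.
rewrite exchange_big; apply: big1 => j _.
transitivity ((u *m A)%R ord0 j *: (v j : L))%R; last by rewrite uA mxE scale0r.
by rewrite mxE scaler_suml; apply: eq_bigr => k _; rewrite scalerA mxE.
Qed.

(** * Realization and extension inside one Fraïssé limit over a finite field *)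

Section FraisseLimit.
Local Open Scope classical_set_scope.
Variables (c : nat) (F : finFieldType).
Local Notation K := (ring_struct_of F).
Variables (M : lie_struct c K) (hM : is_fraisse_limit (@finite_LLA c K) M).

Let M_LLA := fraisse_limit_LLA hM.

Lemma finite_std_lie n (alpha : 'I_n -> 'I_n -> 'I_n -> K)
    (Q : 'I_c.+1 -> set ('I_n -> K)) :
  finite_set [set: std_lie alpha Q].
Proof.
apply: (@sub_finite_set _ _
  ((fun f : {ffun 'I_n -> F} => f : 'I_n -> K) @` setT)).
  by move=> f _; exists (finfun f) => //; apply/funext => i; rewrite ffunE.
exact: finite_image finite_finset.
Qed.

Lemma embed_std_lie n (alpha : 'I_n -> 'I_n -> 'I_n -> K) Q :
  is_LLA (std_lie alpha Q) ->
  exists f : @std_lie c K n alpha Q -> M, embedding f.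
Proof.
move=> lQ; have [_ ageM _] := hM.
by have /ageM [_ [f ef]] := conj lQ (finite_std_lie alpha Q); exists f.
Qed.

Lemma fraisse_limit_realize n (alpha : 'I_n -> 'I_n -> 'I_n -> K)
    (Q : 'I_c.+1 -> set ('I_n -> K)) :
  is_LLA (std_lie alpha Q) -> exists v : 'I_n -> M, realizes v alpha.
Proof.
by move=> /embed_std_lie [f ef]; eexists; apply: embedding_realizes ef.
Qed.

(** [iota] is the inclusion of K^n x 0: [alpha0] keeps brackets inside it and [Qv] matches its
    predicates with those of [M]. Homogeneity applied to [g \o iota] and the coordinate map of [v]
    yields [h], and the missing vectors are the images under [h \o g] of the last [m] basis
    vectors. *)
Lemma fraisse_limit_extend n m (v : 'I_n -> M)
    (alpha : 'I_(n + m) -> 'I_(n + m) -> 'I_(n + m) -> K)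
    (Q : 'I_c.+1 -> set ('I_(n + m) -> K)) :
  is_LLA (std_lie alpha Q) ->
  realizes v (fun i j k => alpha (lshift m i) (lshift m j) (lshift m k)) ->
  (forall i j k, alpha (lshift m i) (lshift m j) (rshift n k) = rzero) ->
  (forall i (a : 'I_n -> K),
     Q i (fcat a (fun _ : 'I_m => rzero)) <-> lpred i (lincomb a v)) ->
  exists w : 'I_m -> M, realizes (fcat v w) alpha.
Proof.
move=> lQ rv alpha0 Qv; have [g eg] := embed_std_lie lQ.
have [_ _ homM] := hM.
have ev := realizes_embedding M_LLA rv.
set A := std_lie _ _ in ev.
pose iota (a : A) : std_lie alpha Q :=
  fcat (a : _ -> K) (fun _ : 'I_m => rzero).
have ei : embedding iota.
  split.
  - move=> x y xy; apply/funext => i.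
    by have := congr1 (fun f => f (lshift m i)) xy;
       rewrite /iota /fcat (unsplitK (inl i)).
  - by apply/funext => i; rewrite /iota /fcat; case: fintype.split.
  - by move=> x y; apply/funext => i; rewrite /iota /fcat /=;
       case: fintype.split => //= _; rewrite addr0.
  - by move=> x y; apply/funext => i; rewrite /iota /fcat /=;
       case: fintype.split => //= _; rewrite subr0.
  - move=> x y; apply/funext => l.
    transitivity (\sum_(i < n + m) \sum_(j < n + m)
      iota x i * iota y j * alpha i j l : F)%R; last by [].
    have il z (i : 'I_n) : iota z (lshift m i) = z i.
      by rewrite /iota /fcat (unsplitK (inl i)).
    have ir z (i : 'I_m) : iota z (rshift n i) = 0%R.
      by rewrite /iota /fcat (unsplitK (inr i)).
    rewrite big_split_ord /= [X in (_ + X)%R]big1 ?addr0; last first.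
      by move=> i _; apply: big1 => j _; rewrite ir !mul0r.
    transitivity (\sum_(i < n) \sum_(j < n)
      x i * y j * alpha (lshift m i) (lshift m j) l : F)%R; last first.
      apply: eq_bigr => i _.
      rewrite big_split_ord /= [X in (_ + X)%R]big1 ?addr0; last first.
        by move=> j _; rewrite ir mulr0 mul0r.
      by apply: eq_bigr => j _; rewrite !il.
    (* For a coordinate [l] past the first [n], both sides vanish, the sum by [alpha0]. *)
    rewrite -(splitK l); case: (fintype.split l) => k /=; first by rewrite il.
    rewrite ir; symmetry; apply: big1 => i _; apply: big1 => j _.
    by rewrite [alpha _ _ _]alpha0 mulr0.
  - by move=> a x; apply/funext => i; rewrite /iota /fcat /=;
       case: fintype.split => //= _; rewrite mulr0.
  - by move=> i x; apply: Qv.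
have egi := embedding_comp eg ei.
have fgA : finitely_generated A.
  by exists setT; [exact: finite_std_lie|move=> S _ TS; apply/seteqP].
have [h [eh _] hE] := homM A _ _ fgA egi ev.
have ehg := embedding_comp eh eg.
exists (fun j => h (g (std_basis K (rshift n j)))).
(* By the choice of [h], [h \o g] sends the first [n] basis vectors to [v], so the whole tuple is
   the image of the standard basis. *)
have -> : fcat v (fun j => h (g (std_basis K (rshift n j)))) =
   (fun i => (h \o g) (std_basis K i)).
  apply/funext => i; rewrite /fcat -{2}(splitK i).
  case: (fintype.split i) => k //=.
  transitivity (h (g (iota (std_basis K k)))).
    by rewrite (hE (std_basis K k)) lincomb_std_basis //; case: M_LLA.
  congr (h (g _)); apply/funext => l; rewrite /iota /fcat /std_basis.
  rewrite -[in RHS](splitK l); case: (fintype.split l) => l' /=.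
    by rewrite eq_lshift.
  by rewrite eq_rlshift.
exact: embedding_realizes.
Qed.

Lemma fraisse_limit_infdim : 0 < c -> infinite_dimensional M.
Proof.
move=> c0 n v spanv.
have [w [indep _]] := fraisse_limit_realize (abelian_LLA F n.+1 c0).
have [vM _ _] := M_LLA.
by apply: (lin_indep_span vM indep (v := v)) => i; rewrite spanv.
Qed.

End FraisseLimit.

(** * Descent of structure constants *)

Section CoordSpan.
Local Open Scope classical_set_scope.

(** Describes a subspace by finitely many scalars, which can be lifted to the factors of an
    ultraproduct. *)
Definition coord_span (R : ring_struct) m n (b : 'I_m -> 'I_n -> R) :
    set ('I_n -> R) :=
  [set x | exists a : 'I_m -> R,
    x = fun j => \big[@radd R/rzero]_(l < m) rmul (a l) (b l j)].

(** The generators are the rows of a square matrix and may be dependent, so every subspace gets the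
    same number of them. *)
Lemma subspace_coord_span_field (F : fieldType) n (S : set ('I_n -> F)) :
  S (fun=> 0%R) -> (forall x y, S x -> S y -> S (fun j => x j + y j)%R) ->
  (forall a x, S x -> S (fun j => a * x j)%R) ->
  exists b : 'I_n -> 'I_n -> ring_struct_of F, S = coord_span b.
Proof.
move=> S0 SD SZ.
(* S is the row space of a matrix of maximal rank with row space inside S. *)
pose inS (A : 'M[F]_n) :=
  forall u : 'rV_n, (u <= A)%MS -> S (fun j => u ord0 j).
pose rk r := `[< exists A, inS A /\ \rank A = r >].
have rk0 : exists r, rk r.
  exists 0; apply/asboolP; exists 0%R; rewrite mxrank0; split=> // u.
  rewrite submx0 => /eqP ->.
  by have -> : (fun j => (0 : 'rV[F]_n)%R ord0 j) = (fun=> 0%R)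
    by apply/funext => j; rewrite mxE.
have rk_le r : rk r -> r <= n.
  by move=> /asboolP [A [_ <-]]; apply: rank_leq_row.
have [r /asboolP [A [SA rA]] maxr] := ex_maxnP rk0 rk_le.
exists (fun l j => A l j).
have Arow (u : 'rV_n) j : (u *m A)%R ord0 j = (\sum_l u ord0 l * A l j)%R.
  by rewrite mxE.
apply/seteqP; split=> [x Sx|_ [a ->]]; last first.
  have := SA (\row_l a l *m A)%R (submxMl _ _); congr S; apply/funext => j.
  by rewrite Arow; apply: eq_bigr => l _; rewrite mxE.
pose u : 'rV[F]_n := (\row_j x j)%R.
(* Adjoining the row [u] to [A] keeps the row space inside [S], so by maximality of the rank the row
   space does not grow. *)
have uA : (u <= A)%MS.
  pose B := (A + u)%MS.
  have SB : inS B.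
    move=> w /sub_addsmxP [[w1 w2] /= ->].
    have -> : (fun j => (w1 *m A + w2 *m u)%R ord0 j) =
        (fun j => (w1 *m A)%R ord0 j + w2 ord0 ord0 * x j)%R.
      apply/funext => j; rewrite mxE; congr (_ + _)%R.
      by rewrite mxE big_ord1 mxE.
    by apply: SD; [apply: SA; apply: submxMl|apply: SZ].
  have /maxr rB : rk (\rank B) by apply/asboolP; exists B.
  have /mxrank_leqif_eq [_ eAB] : (A <= B)%MS by apply: addsmxSl.
  have /andP [_ BA] : (A == B)%MS.
    by rewrite -eAB eqn_leq rA rB andbT -rA mxrankS ?addsmxSl.
  exact: submx_trans (addsmxSr _ _) BA.
have [a /rowP ua] := submxP uA.
exists (fun l => a ord0 l); apply/funext => j.
by have := ua j; rewrite mxE Arow.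
Qed.

Lemma LLA_coord_span c (R : ring_struct) n (alpha : 'I_n -> 'I_n -> 'I_n -> R)
    (Q : 'I_c.+1 -> set ('I_n -> R)) k :
  is_field R -> is_LLA (std_lie alpha Q) ->
  exists b : 'I_n -> 'I_n -> R, Q k = coord_span b.
Proof.
move=> /is_field_ring_struct_of [F defR]; subst R => -[_ _ lz].
(* [Q k] is the term of index k+1 of the series. *)
have [[S0 SD SZ] _] := lz_sub lz (ltn0Sn k).
have kE : @series_term c _ (std_lie alpha Q) k.+1 = Q k.
  by rewrite /series_term /= valK.
by rewrite kE in S0 SD SZ; apply: subspace_coord_span_field.
Qed.

End CoordSpan.

(** * Structure constants and realizations across an ultraproduct *)

Section StdLieLos.
Local Open Scope classical_set_scope.
Context (I : Type) (D : set_system I) {hD : UltraFilter D}.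
Variables (R : I -> ring_struct) (K : ring_struct) (rq : (forall i, R i) -> K).
Hypothesis hr : ring_presents D rq.
Variable c : nat.

Let r_surj := pres_surj (rp_presents hr).
Let r_eq := pres_eq (rp_presents hr).

Definition tup3 n (alpha : forall i, 'I_n -> 'I_n -> 'I_n -> R i) :
    'I_n -> 'I_n -> 'I_n -> K :=
  fun a b k => rq (fun i => alpha i a b k).

Lemma tup3_surj n (alpha' : 'I_n -> 'I_n -> 'I_n -> K) :
  exists alpha, alpha' = tup3 alpha.
Proof.
have [f fE] := choice (fun t : 'I_n * 'I_n * 'I_n =>
  r_surj (alpha' t.1.1 t.1.2 t.2)).
exists (fun i a b k => f (a, b, k) i).
apply/funext => a; apply/funext => b; apply/funext => k.
exact: (fE (a, b, k)).
Qed.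

Lemma los_coord_span m n (b : forall i, 'I_m -> 'I_n -> R i)
    (x : forall i, 'I_n -> R i) :
  los D (fun i => coord_span (b i) (x i))
    (coord_span (fun l j => rq (fun i => b i l j)) (tup rq x)).
Proof.
apply: (los_exists (tup_surj r_surj (n := m)) (fun i _ => rzero)) => a.
apply: (@los_iff _ _ _ _
  (fun i => forall j,
     x i j = \big[@radd (R i)/rzero]_(l < m) rmul (a i l) (b i l j))
  (forall j, tup rq x j = \big[@radd K/rzero]_(l < m)
     rmul (tup rq a l) (rq (fun i => b i l j)))).
- by move=> i; split=> [-> //|?]; apply/funext.
- by split=> [-> //|?]; apply/funext.
apply: los_fin => j.
have -> :
    \big[@radd K/rzero]_(l < m) rmul (tup rq a l) (rq (fun i => b i l j)) =
    rq (fun i => \big[@radd (R i)/rzero]_(l < m) rmul (a i l) (b i l j)).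
  rewrite (pres_big _ _ _ (rp_zero hr) (rp_add hr)).
  by apply: eq_bigr => l _; rewrite (rp_mul hr).
exact: r_eq.
Qed.

(** Makes the transfer lemmas for Lie structures available for K^n itself. *)
Lemma std_lie_presents n (alpha : forall i, 'I_n -> 'I_n -> 'I_n -> R i)
    (Q : forall i, 'I_c.+1 -> set ('I_n -> R i))
    (Q' : 'I_c.+1 -> set ('I_n -> K)) :
  (forall k x, los D (fun i => Q i k (x i)) (Q' k (tup rq x))) ->
  @lie_presents _ D R K rq c (fun i => std_lie (alpha i) (Q i))
    (std_lie (tup3 alpha) Q') (tup rq (n := n)).
Proof.
move=> hQ; split=> //=.
- split; first exact: tup_surj.
  move=> x y; apply: (@los_iff _ _ _ _ (fun i => forall j, x i j = y i j)
    (forall j, tup rq x j = tup rq y j)).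
  + by move=> i; split=> [-> //|?]; apply/funext.
  + by split=> [-> //|?]; apply/funext.
  by apply: los_fin => j; apply: r_eq.
- by apply/funext => j; apply: (rp_zero hr).
- by move=> x y; apply/funext => j; apply: (rp_add hr).
- by move=> x y; apply/funext => j; apply: (rp_sub hr).
- move=> x y; apply/funext => j; rewrite {1}/tup.
  rewrite (pres_big _ _ _ (rp_zero hr) (rp_add hr)); apply: eq_bigr => a _.
  rewrite (pres_big _ _ _ (rp_zero hr) (rp_add hr)); apply: eq_bigr => b _.
  by rewrite !(rp_mul hr).
- by move=> a x; apply/funext => j; apply: (rp_mul hr).
Qed.

(** The entries of generators of each [Q' k] are lifted to the factors, where they span the sets
    [Q i k]; then [los_LLA] applies to K^n. *)
Lemma std_LLA_descends n (alpha : forall i, 'I_n -> 'I_n -> 'I_n -> R i)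
    (Q' : 'I_c.+1 -> set ('I_n -> K)) :
  is_field K -> is_LLA (std_lie (tup3 alpha) Q') ->
  exists Q : forall i, 'I_c.+1 -> set ('I_n -> R i),
    (forall k x, los D (fun i => Q i k (x i)) (Q' k (tup rq x))) /\
    D (fun i => is_LLA (std_lie (alpha i) (Q i))).
Proof.
move=> fK lQ'.
have /choice [b' b'E] := fun k => LLA_coord_span k fK lQ'.
have /choice [b bE] : forall t : 'I_c.+1 * 'I_n * 'I_n,
    exists y, b' t.1.1 t.1.2 t.2 = rq y by move=> t; apply: r_surj.
pose Q i k := coord_span (fun l j => b (k, l, j) i).
have hQ k x : los D (fun i => Q i k (x i)) (Q' k (tup rq x)).
  rewrite b'E.
  have -> : b' k = fun l j => rq (fun i => b (k, l, j) i).
    by apply/funext => l; apply/funext => j; apply: (bE (k, l, j)).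
  exact: los_coord_span.
exists Q; split=> //.
by apply/(los_LLA hr (std_lie_presents _ hQ)).
Qed.

Variables (V : forall i, lie_struct c (R i)) (W : lie_struct c K).
Variable q : (forall i, V i) -> W.
Hypothesis hq : lie_presents D rq q.

Let q_surj := pres_surj (lp_presents hq).
Let q_eq := pres_eq (lp_presents hq).

Lemma los_realizes n (v : forall i, 'I_n -> V i) alpha :
  los D (fun i => realizes (v i) (alpha i)) (realizes (tup q v) (tup3 alpha)).
Proof.
apply: los_and; first exact: (los_lin_indep hr hq).
apply: los_fin => i; apply: los_fin => j.
rewrite -(lp_br hq) -[tup3 _ _ _]/(tup rq (fun p => alpha p i j)).
by rewrite -(lp_lincomb hq); apply: q_eq.
Qed.

End StdLieLos.

(** * The ultraproduct of the structures M_p *)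

Section ModelsT0.
Local Open Scope classical_set_scope.
Variable c : nat.

Lemma lincomb_inj (R : ring_struct) (V : lie_struct c R) n (v : 'I_n -> V)
    (a b : 'I_n -> R) :
  is_field R -> is_vector_space V -> lin_indep v ->
  lincomb a v = lincomb b v -> a = b.
Proof.
move=> /is_field_ring_struct_of [F defR]; subst R.
move=> /is_vector_space_lmod [L [br [P defV]]]; subst V => indep ab.
apply/funext => i; apply/eqP; rewrite -subr_eq0; apply/eqP.
apply: (indep (fun i => a i - b i)%R).
transitivity (\sum_i (a i - b i) *: (v i : L))%R => //.
under eq_bigr do rewrite scalerBl.
by rewrite sumrB; apply/eqP; rewrite subr_eq0; apply/eqP.
Qed.

(** [kv_of] takes its coefficients by choice; independence makes them unique. *)
Lemma kv_of_pi (R : ring_struct) (V : lie_struct c R) n (v : 'I_n -> V)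
    (a : 'I_n -> R) :
  is_field R -> is_vector_space V -> lin_indep v ->
  Defs.pi (kv_of V) v (lincomb a v) = a.
Proof.
move=> fR vV indep /=; case: pselect => [h|[]]; last by exists a.
by case: cid => b [_ ab] /=; apply: esym (lincomb_inj fR vV indep ab).
Qed.

Lemma kv_of_pi_default (R : ring_struct) (V : lie_struct c R) n
    (v : 'I_n -> V) w :
  ~ (lin_indep v /\ lin_span v w) -> Defs.pi (kv_of V) v w = fun=> rzero.
Proof.
move=> nvw /=; case: pselect => // h; case: nvw.
by have [a [indep wE]] := h; split=> //; exists a.
Qed.

Variable M : kv_struct c.
Hypothesis hM : models_T0 M.

Lemma realizes_Str n (v : 'I_n -> Vsort M) alpha i j k :
  realizes v alpha -> Str v i j k = alpha i j k.
Proof. by move=> [indep brE]; rewrite /Str brE (T0_pi hM). Qed.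

Lemma subalgebra_basis_realizes n (v : 'I_n -> Vsort M) :
  subalgebra_basis v -> realizes v (Str v).
Proof.
move=> [indep [[_ _ _] closed]]; split=> // i j.
have vspan l : lin_span v (v l).
  exists (std_basis _ l).
  have [+ _ _] := T0_LLA hM.
  (* The sorts are generalized to variables so that the ring can be substituted by a MathComp
     field. *)
  move: (Vsort M) v l {indep closed} (T0_field hM).
  move: (Ksort M) => R V v l /is_field_ring_struct_of [F defR]; subst R.
  by move=> vV; rewrite lincomb_std_basis.
have [a aE] := closed _ _ (vspan i) (vspan j).
by rewrite /Str aE; congr lincomb; apply/funext => k; rewrite (T0_pi hM).
Qed.

Lemma realizes_basis n (v : 'I_n -> Vsort M) alpha :
  realizes v alpha -> subalgebra_basis v.
Proof.
have := T0_LLA hM; move: (Vsort M) v alpha (T0_field hM); move: (Ksort M) => R.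
move=> V v alpha /is_field_ring_struct_of [F defR]; subst R.
exact: realizes_subalgebra_basis.
Qed.

End ModelsT0.

Lemma tup_fcat (I : Type) (X : I -> Type) X' (q : (forall i, X i) -> X') n m
    (v : forall i, 'I_n -> X i) (w : forall i, 'I_m -> X i) :
  fcat (tup q v) (tup q w) = tup q (fun i => fcat (v i) (w i)).
Proof. by apply/funext => j; rewrite /fcat /tup; case: fintype.split. Qed.

(** * The ultraproduct over the primes is a model of T^+ *)

Section PrimeUltraproduct.
Local Open Scope classical_set_scope.
Context (D : set_system primes_type) {hD : UltraFilter D}.
Hypothesis hDnp : nonprincipal D.

Lemma Fp_field p : is_field (Fp p).
Proof. exact: ring_struct_of_field. Qed.

(** An ultrafilter containing a singleton is principal, so [D] contains the complement of each
    prime; the induction discards one number at a time. *)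
Lemma large_primes n : D (fun p => n < sval p).
Proof.
have not1 p : D (~` [set p]).
  have [Dp|//] := in_ultra_setVsetC [set p] hD; case: (@hDnp p).
  apply/seteqP; split=> A.
    move=> DA; apply/principal_filterP.
    by have [_ [/= -> //]] := filter_ex (filterI Dp DA).
  by move=> /principal_filterP Ap; apply: filterS Dp => _ ->.
elim: n => [|n IHn].
  by apply: filterS (filterT) => -[p pp] _; apply: prime_gt0.
have [prn|nprn] := boolP (prime n.+1).
  pose q : primes_type := exist _ n.+1 prn.
  have := not1 q; apply: filterS2 IHn => -[p pp] /= ltnp pn.
  rewrite ltn_neqAle ltnp andbT; apply/eqP => np; apply: pn.
  by apply: eq_exist.
apply: filterS IHn => -[p pp] /= ltnp; rewrite ltn_neqAle ltnp andbT.
by apply/eqP => np; rewrite np pp in nprn.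
Qed.

Local Notation K := (ring_uprod D Fp).

Lemma Fp_uprod_pseudo_finite : pseudo_finite K.
Proof.
have hr := @ring_uprod_presents _ D hD Fp.
split.
- exact: los_field hr Fp_field.
- move=> finK.
  pose g n : K := rupi D (fun p : primes_type => (n%:R : 'F_(sval p))%R : Fp p).
  (* Almost every [p] exceeds [m], and for such [p] the residues of n < m differ. *)
  have g_inj n m : n < m -> g n <> g m.
    move=> ltnm /(pres_eq (rp_presents hr)) Dnm.
    have [[p pp] /= [nm ltmp]] := filter_ex (filterI Dnm (large_primes m)).
    have := congr1 (@nat_of_ord _) nm.
    rewrite !val_Fp_nat // !modn_small ?(ltn_trans ltnm) // => nm'.
    by rewrite nm' ltnn in ltnm.
  apply: infinite_nat.
  rewrite -[setT](preimage_setT g); apply: finite_preimage => // n m _ _ gnm.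
  by case: (ltngtP n m) => // /g_inj; rewrite gnm.
move=> f ff; apply: (los_rsat hr) => p; apply: ff; first exact: Fp_field.
exact: (@finite_finset 'F_(sval p)).
Qed.

Variable c : nat.
Variable L : forall p : primes_type, lie_struct c (Fp p).
Hypothesis hL : forall p, is_fraisse_limit (@finite_LLA c (Fp p)) (L p).

Local Notation rK := (rupi D (R := Fp)).
Local Notation qL := (lupi D (V := L)).
Local Notation W := (lie_uprod D L).
Local Notation M := (ultraproduct D (fun p => kv_of (L p))).

Let hr := @ring_uprod_presents _ D hD Fp.
Let hq := @lie_uprod_presents _ D hD _ _ L.
Let q_surj := pres_surj (lp_presents hq).
Let L_LLA p := fraisse_limit_LLA (hL p).

Lemma ultraproduct_T0 : models_T0 M.
Proof.
have r_surj := pres_surj (rp_presents hr).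
(* [theta] and [pi] of the ultraproduct are evaluated at the representatives given by [urepr], so
   tuples are rewritten through these. *)
have reprE n (v : 'I_n -> W) :
    v = tup qL (fun p j => urepr (v j) p).
  by apply/funext => j; rewrite /tup /lupi upi_urepr.
have wE (w : W) : w = qL (urepr w) by rewrite /lupi upi_urepr.
have LV p : is_vector_space (L p) by case: (L_LLA p).
split.
- exact: los_field hr Fp_field.
- exact: los_true (los_LLA hr hq) L_LLA.
- move=> n v; rewrite {2}(reprE _ v); apply: iff_sym.
  exact: (los_lin_indep hr hq).
- move=> n v a indep i.
  have [b bE] := tup_surj r_surj a.
  rewrite [RHS](_ : _ = rupi D (fun p => b p i)); last by rewrite bE.
  apply/(pres_eq (rp_presents hr)).
  move: indep; rewrite {1}(reprE _ v) => /(los_lin_indep hr hq) indep.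
  (* The representative of a linear combination is almost everywhere the combination of the
     representatives, where [kv_of_pi] reads off the coefficients. *)
  have : qL (urepr (lincomb a v : W)) =
      qL (fun p => lincomb (b p) (fun j => urepr (v j) p)).
    by rewrite -wE (lp_lincomb hq) -bE -reprE.
  move=> /(pres_eq (lp_presents hq)).
  apply: filterS2 indep => p indep wE_p.
  exact: etrans (congr1 (fun w => Defs.pi (kv_of (L p)) _ w i) wE_p)
    (congr1 (fun f => f i) (kv_of_pi _ (Fp_field p) (LV p) indep)).
move=> n v w nvw i; apply/(pres_eq (rp_presents hr)).
have : D (fun p => ~ (lin_indep (fun j => urepr (v j) p) /\
    lin_span (fun j => urepr (v j) p) (urepr w p))).
  apply/(los_not (los_and (los_lin_indep hr hq _) (los_lin_span hr hq _ _))).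
  by rewrite -reprE -wE.
by apply: filterS => p /kv_of_pi_default /= ->.
Qed.

Let hM := ultraproduct_T0.

Let los_exists_realizing n m (v : forall p, 'I_n -> L p) alpha :
  los D (fun p => exists w : 'I_m -> L p, realizes (fcat (v p) w) (alpha p))
    (exists w : 'I_m -> W, realizes (fcat (tup qL v) w) (tup3 rK alpha)).
Proof.
apply: (los_exists (tup_surj q_surj (n := m)) (fun i _ => lzero)) => w.
by rewrite tup_fcat; apply: (los_realizes hr hq).
Qed.

Lemma ultraproduct_realize n (alpha : 'I_n -> 'I_n -> 'I_n -> K) :
  structure_constants c alpha -> exists v : 'I_n -> W, realizes v alpha.
Proof.
have [beta ->] := tup3_surj hr alpha.
move=> [s [k [_ _ _ lQ]]].
have [Q [_ DQ]] := std_LLA_descends hr (los_field hr Fp_field) lQ.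
have : D (fun p => exists v : 'I_n -> L p, realizes v (beta p)).
  apply: filterS DQ => p.
  exact: (@fraisse_limit_realize c 'F_(sval p) _ (hL p)).
apply: (proj2 (los_exists (tup_surj q_surj (n := n)) (fun i _ => lzero) _)).
by move=> v; apply: (los_realizes hr hq).
Qed.

Lemma ultraproduct_extend n m (v : 'I_n -> W)
    (alpha : 'I_(n + m) -> 'I_(n + m) -> 'I_(n + m) -> K) :
  realizes v (fun i j k => alpha (lshift m i) (lshift m j) (lshift m k)) ->
  (forall (i j : 'I_n) (k : 'I_m),
      alpha (lshift m i) (lshift m j) (rshift n k) = rzero) ->
  lazard_compatible (M := M) v alpha ->
  exists w : 'I_m -> W, realizes (fcat v w) alpha.
Proof.
have [beta ->] := tup3_surj hr alpha.
have [u ->] := tup_surj q_surj v.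
move=> rv alpha0 [Q' [lQ' Q'v]].
have [Q [hQ DQ]] := std_LLA_descends hr (los_field hr Fp_field) lQ'.
apply/los_exists_realizing.
have Dv : D (fun p => realizes (u p)
    (fun i j k => beta p (lshift m i) (lshift m j) (lshift m k))).
  exact/(los_realizes hr hq u).
have D0 : D (fun p => forall i j k,
    beta p (lshift m i) (lshift m j) (rshift n k) = rzero).
  apply/(los_fin (fun i => los_fin (fun j => los_fin (fun k =>
    pres_eq (rp_presents hr)
      (fun p => beta p (lshift m i) (lshift m j) (rshift n k))
      (fun=> rzero))))) => i j k.
  exact: alpha0.
(* There are finitely many predicates, and [a] ranges over a presented ultraproduct, so agreement of
   the series on the span of [v] descends too. *)
have Dcompat : D (fun p => forall i (a : 'I_n -> Fp p),
    Q p i (fcat a (fun _ : 'I_m => rzero)) <-> lpred i (lincomb a (u p))).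
  pose P' i (a : 'I_n -> K) := Q' i (fcat a (fun _ : 'I_m => rzero)) <->
    @lpred c K W i (lincomb a (tup qL u)).
  apply/(los_fin (P' := fun i => forall a, P' i a)) => [i|]; last exact: Q'v.
  apply: (los_forall (tup_surj (pres_surj (rp_presents hr)) (n := n))
    (fun p _ => rzero)) => a.
  apply: los_equiv.
    by rewrite (tup_fcat rK a (fun p _ => rzero)); apply: hQ.
  by rewrite -(lp_lincomb hq); apply: (lp_pred hq).
apply: filterS2 (filterI DQ Dv) (filterI D0 Dcompat) => p [lQ rv_p] [b0 compat].
exact: (@fraisse_limit_extend c 'F_(sval p) _ (hL p) _ _ _ _ _
  lQ rv_p b0 compat).
Qed.

Lemma ultraproduct_Tplus :
  0 < c -> models_Tplus theory_of_pseudo_finite_fields M.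
Proof.
move=> c0; split=> //.
- by move=> f; apply; apply: Fp_uprod_pseudo_finite.
- apply: (los_infinite_dimensional hr hq) => p.
  exact: (@fraisse_limit_infdim c 'F_(sval p) _ (hL p) c0).
- move=> n alpha /ultraproduct_realize [v rv]; exists v.
  split; first exact: realizes_basis hM _ _ _ rv.
  by move=> i j k; apply: realizes_Str.
move=> n m _ v alpha bv _ alphaE alpha0 compat.
(* [v] realizes its own structure constants, which [alphaE] identifies with the block of [alpha] on
   the first [n] indices. *)
have rv := subalgebra_basis_realizes hM bv.
have [|w rw] := ultraproduct_extend (v := v) _ alpha0 compat.
  have -> // :
      (fun i j k => alpha (lshift m i) (lshift m j) (lshift m k)) = Str v.
  by do 3![apply/funext => ?]; apply: alphaE.
exists w; split; first exact: realizes_basis hM _ _ _ rw.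
by move=> i j k; apply: realizes_Str.
Qed.

End PrimeUltraproduct.

Theorem theorem3p8 (c : nat) (hc : 1 <= c)
  (L : forall p : primes_type, lie_struct c (Fp p))
  (hL : forall p, is_fraisse_limit (@finite_LLA c (Fp p)) (L p))
  (D : set_system primes_type) (hD : UltraFilter D) (hDnp : nonprincipal D) :
  models_Tplus theory_of_pseudo_finite_fields
    (ultraproduct D (fun p => kv_of (L p))).
Proof. exact: ultraproduct_Tplus. Qed.
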